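(* In the random matching model with $n$ boys and $n$ girls, let $F$ be a minimum winning coalition (a winning coalition of girls of smallest cardinality). Then, as $n\to\infty$, the expected cardinality of $F$ satisfies $$\mathbb{E}(|F|)=\tfrac{1}{2}\log n+O(\log\log n).$$
   Context: $\log$ is the natural logarithm. A stable matching instance consists of a set $B=\{b_1,\dots,b_n\}$ of boys and a set $G=\{g_1,\dots,g_n\}$ of girls, where every boy has a strict preference ranking over all girls and every girl has a strict preference ranking over all boys. A perfect matching $\mu$ between boys and girls is stable if there is no pair $(b,g)$ such that $b$ prefers $g$ to $\mu(b)$ and $g$ prefers $b$ to $\mu(g)$. A stable-partner of a person is anyone matched to that person in some stable matching; the best stable-partner is the most preferred one. The set of stable matchings is a distributive lattice under the order $\mu_1\geqslant\mu_2$ iff every boy weakly prefers his partner in $\mu_1$ to his partner in $\mu_2$. Its minimum element $\mathbf{0}$ is the girl-optimal (boy-pessimal) stable matching, in which every girl is matched to her best stable-partner. For $F\subseteq G$, let $\mathcal{M}_F$ be the set of stable matchings in which every girl in $F$ is matched to her best stable-partner; it is a (nonempty) lattice under $\geqslant$, and $\mathbf{1}_F$ denotes its maximum element. $F$ is a winning coalition if $\mathbf{1}_F=\mathbf{0}$; a minimum winning coalition is a winning coalition of smallest cardinality. Random matching model: the preference rankings of the $n$ boys and $n$ girls are independent, each a uniformly random permutation of the members of the other side. *)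

(* Defs.v *)
From HB Require Import structures.
From mathcomp Require Import all_boot all_order all_algebra all_fingroup.
From mathcomp Require Import all_classical all_reals all_analysis.
Set Implicit Arguments. Unset Strict Implicit. Unset Printing Implicit Defensive.
Import Order.TTheory GRing.Theory Num.Theory.
Import numFieldNormedType.Exports.
Local Open Scope ring_scope.

Section StableMatching.
Variable n : nat.

(* Boys and girls are both indexed by 'I_n.  A strict ranking of the n members
   of the other side is a permutation sending each member to their position in
   the list, position 0 being the most preferred. *)
Definition ranking := 'S_n.
Definition profile := ({ffun 'I_n -> ranking} * {ffun 'I_n -> ranking})%type.

Implicit Types (P : profile) (b g : 'I_n) (F : {set 'I_n}).

Definition boy_prefers P b g1 g2 : bool := (P.1 b g1 < P.1 b g2)%N.
Definition girl_prefers P g b1 b2 : bool := (P.2 g b1 < P.2 g b2)%N.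

(* A perfect matching as the bijection from boys to girls. *)
Definition matching := 'S_n.
Implicit Types (mu nu : matching) (M : {set matching}).
Definition girl_of mu b : 'I_n := mu b.
Definition boy_of mu g : 'I_n := (mu^-1)%g g.

Definition stable P mu : bool :=
  ~~ [exists b, exists g,
        boy_prefers P b g (girl_of mu b) && girl_prefers P g b (boy_of mu g)].
Definition stable_matchings P : {set matching} := [set mu | stable P mu].

Definition stable_partner P g b : bool :=
  [exists mu in stable_matchings P, boy_of mu g == b].
Definition best_stable_partner P g b : bool :=
  stable_partner P g b &&
  [forall b', stable_partner P g b' ==> (b' != b) ==> girl_prefers P g b b'].

Definition matching_ge P mu1 mu2 : bool :=
  [forall b, (girl_of mu1 b == girl_of mu2 b) ||
             boy_prefers P b (girl_of mu1 b) (girl_of mu2 b)].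

Definition is_maximum P M mu : bool :=
  (mu \in M) && [forall nu in M, matching_ge P mu nu].
Definition is_minimum P M mu : bool :=
  (mu \in M) && [forall nu in M, matching_ge P nu mu].

Definition stable_best_for P F : {set matching} :=
  [set mu in stable_matchings P |
     [forall g in F, best_stable_partner P g (boy_of mu g)]].

(* The maximum of M_F equals the minimum of the lattice: one matching is both
   (each is unique by antisymmetry, rankings being injective). *)
Definition winning_coalition P F : bool :=
  [exists mu, is_maximum P (stable_best_for P F) mu &&
              is_minimum P (stable_matchings P) mu].

Definition minimum_winning_coalition P F : Prop :=
  winning_coalition P F /\
  forall F' : {set 'I_n}, winning_coalition P F' -> (#|F| <= #|F'|)%N.

End StableMatching.

Section RandomMatching.
Variables (R : realType) (n : nat).

Definition uniform_mass (T : finType) (x : T) : R := #|T|%:R^-1.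

(* Independence of the 2n rankings: the joint mass is the product of the
   individual ones. *)
Definition profile_mass (P : profile n) : R :=
  (\prod_(b < n) uniform_mass (P.1 b)) * (\prod_(g < n) uniform_mass (P.2 g)).

Definition expected_value (X : profile n -> R) : R :=
  \sum_(P : profile n) X P * profile_mass P.

End RandomMatching.

(* Main.v *)
(** A coalition is winning iff it meets every rotation exposed at the
    girl-optimal matching, i.e. every cycle of length at least 2 of the map
    [succ] that sends a girl [g] to the partner of the first boy, further down
    her list, who prefers [g] to that partner.  These cycles are disjoint, so a
    minimum winning coalition has one girl in each, and the expected number of
    cycles is the sum over [k] of [1/k] times the expected number of girls on a
    cycle of length [k].

    The rankings are revealed as the girls propose: the next boy is uniform among
    those not yet approached, and a boy who has received [k] proposals accepts
    the next one with probability [1/(k+1)].  After the girl-proposing algorithm,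
    [succ] is followed from a girl by letting her propose again.  All weights
    [1/(k+1)] are at least of order [1/log n], and exploring about [sqrt n] steps
    hardly changes their sum, so the chain returns to its starting boy at step
    [k] with probability close to his weight over the total weight.  Summing over
    the starting boys, about one girl is expected on the cycles of length [k], as
    long as [k] is at most [sqrt n] up to a power of [log n]; longer cycles are
    unlikely by the birthday argument.  The sum of [1/k] up to there is
    [1/2 log n + O(log log n)].

    Exceptional histories (too many proposals in total, to one boy, or by one
    girl) are discounted by potentials that are supermartingales, at least 1 on
    the exceptional states, and polynomially small at the start. *)
Require Import Defs.
From HB Require Import structures.
From mathcomp Require Import all_boot all_order all_algebra all_fingroup.
From mathcomp Require Import all_classical all_reals all_analysis.
From mathcomp Require Import zify ring lra.
Set Implicit Arguments. Unset Strict Implicit. Unset Printing Implicit Defensive.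
Import Order.TTheory GRing.Theory Num.Theory.
Import numFieldNormedType.Exports.
Local Open Scope ring_scope.

(** * Rankings with a known beginning or a known relative order *)

Section PartialLists.
Variable n : nat.
Implicit Types (p l : seq 'I_n) (r : 'S_n) (x y : 'I_n).

(** A state of knowledge is a set of profiles and [cexp] an average over it. Every estimate is a
    backward induction over proposals, of the form: conditional expectation at most a main term plus
    a potential. Where the potential reaches 1 the estimate is trivial, so the induction step only
    treats typical states, and the exceptional ones cost no more than the initial potential. Lower
    bounds are upper bounds for the negated variable.

    Chains are started from the same final state of the proposal phase for every girl and every
    length, so the final potential is multiplied by about n log n; this is why it must be
    polynomially small.

    The two halves have different horizons. The upper bound follows chains up to sqrt n times a
    power of log n, beyond which the birthday argument makes cycles negligible. The lower bound
    stops at sqrt n divided by a power of log n, where the excluded boys (those on the path, and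
    those whose partners have approached the starting boy) are still too few to matter. The gap
    between the logarithms of the horizons is the O(log log n). *)

Definition starts_with p r := [seq val (r x) | x <- p] == iota 0 (size p).
Definition ranked_as l r := sorted ltn [seq val (r x) | x <- l].
Definition insert i x l := take i l ++ x :: drop i l.
Definition position l x r := count (fun y => r y < r x)%N l.

Lemma size_insert i x l : size (insert i x l) = (size l).+1.
Proof. by rewrite size_cat /= addnS -size_cat cat_take_drop. Qed.

Lemma mem_insert i x l y : (y \in insert i x l) = (y == x) || (y \in l).
Proof. by rewrite mem_cat inE orbCA -mem_cat cat_take_drop. Qed.

Lemma perm_insert i x l : perm_eq (insert i x l) (x :: l).
Proof. by rewrite perm_catC /= perm_cons perm_catC cat_take_drop. Qed.

Lemma uniq_insert i x l : uniq (insert i x l) = (x \notin l) && uniq l.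
Proof. by rewrite (perm_uniq (perm_insert i x l)). Qed.

Lemma starts_with_rcons p x r :
  starts_with (rcons p x) r = starts_with p r && (r x == size p :> nat).
Proof.
rewrite /starts_with map_rcons size_rcons -addn1 iotaD /= add0n cats1.
by rewrite eqseq_rcons.
Qed.

Lemma starts_with_lt p r x y :
  starts_with p r -> x \in p -> y \notin p -> (r x < r y)%N.
Proof.
move=> /eqP pr xp yp.
have rx : (r x < size p)%N.
  have : val (r x) \in iota 0 (size p) by rewrite -pr (map_f (fun z => val (r z))).
  by rewrite mem_iota.
rewrite ltnNge; apply: contra yp => ryx.
have : val (r y) \in iota 0 (size p).
  by rewrite mem_iota /= add0n; apply: leq_ltn_trans rx.
by rewrite -pr => /mapP[z zp /val_inj/perm_inj ->].
Qed.

Lemma starts_with_notin p r x : starts_with p r -> r x = size p :> nat -> x \notin p.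
Proof.
move=> /eqP pr rx; apply/negP => xp.
have : val (r x) \in iota 0 (size p) by rewrite -pr (map_f (fun z => val (r z))).
by rewrite mem_iota /= rx ltnn.
Qed.

Lemma ranked_map (s : 'S_n) l r :
  ranked_as (map s l) r = ranked_as l (s * r)%g.
Proof.
by rewrite /ranked_as -map_comp; congr sorted; apply: eq_map => x /=; rewrite permM.
Qed.

Lemma starts_with_map (s : 'S_n) p r :
  starts_with (map s p) r = starts_with p (s * r)%g.
Proof.
rewrite /starts_with -map_comp size_map; congr (_ == _).
by apply: eq_map => x /=; rewrite permM.
Qed.

(** Left multiplication by a permutation is a bijection of rankings; this symmetry is the source of
    all uniformity below. *)
Lemma card_ranked_map (s : 'S_n) l :
  #|[pred r | ranked_as (map s l) r]| = #|[pred r | ranked_as l r]|.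
Proof.
rewrite -[RHS](card_imset _ (@mulgI _ s^-1%g)) [LHS]cardE [RHS]cardE.
rewrite -!cardE; apply: eq_card => r; rewrite !inE ranked_map.
apply/idP/imsetP => [rl|[r' r'l ->]].
  by exists (s * r)%g => //; rewrite mulKg.
by move: r'l; rewrite inE mulKVg.
Qed.

Lemma card_starts_map (s : 'S_n) p :
  #|[pred r | starts_with (map s p) r]| = #|[pred r | starts_with p r]|.
Proof.
rewrite -[RHS](card_imset _ (@mulgI _ s^-1%g)).
apply: eq_card => r; rewrite !inE starts_with_map.
apply/idP/imsetP => [rl|[r' r'l ->]].
  by exists (s * r)%g => //; rewrite mulKg.
by move: r'l; rewrite inE mulKVg.
Qed.

Lemma card_notin p : uniq p -> #|[pred x | x \notin p]| = (n - size p)%N.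
Proof.
move=> up; have := cardC (mem p); rewrite card_ord (card_uniqP up) => np.
by rewrite -[X in (X - _)%N]np addKn; apply: eq_card.
Qed.

(** The rankings beginning with [p] split according to the next entry, and transposing two
    candidates shows that all classes have the same size: the next proposal is uniform among the
    boys not yet approached. *)
Lemma card_starts_rcons p x :
  uniq p -> x \notin p ->
  (#|[pred r | starts_with (rcons p x) r]| * (n - size p))%N
  = #|[pred r | starts_with p r]|.
Proof.
move=> up xp.
have ltpn : (size p < n)%N.
  have : uniq (x :: p) by rewrite /= xp.
  by move/card_uniqP => /= <-; rewrite -[X in (_ <= X)%N]card_ord max_card.
have -> : #|[pred r | starts_with p r]| =
  (\sum_(y | y \notin p) #|[pred r | starts_with (rcons p y) r]|)%N.
  rewrite -sum1_card (partition_big (fun r : 'S_n => (r^-1)%g (Ordinal ltpn))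
    (fun y => y \notin p)) /=; last first.
    by move=> r pr; apply: starts_with_notin pr _; rewrite permKV.
  apply: eq_bigr => y yp; rewrite -sum1_card; apply: eq_bigl => r.
  rewrite !inE starts_with_rcons; congr (_ && _).
  apply/eqP/eqP => [<-|ry]; first by rewrite permKV.
  by rewrite -[RHS](permK r); congr (_ _); apply: val_inj.
rewrite (eq_bigr (fun=> #|[pred r | starts_with (rcons p x) r]|)) => [|y yp].
  rewrite sum_nat_const mulnC; congr muln.
  by rewrite -card_notin.
rewrite -[RHS](card_starts_map (tperm x y)) map_rcons tpermL.
have -> // : map (tperm x y) p = p.
apply: map_id_in => z zp; rewrite tpermD //.
  by apply: contraNneq xp => ->.
by apply: contraNneq yp => ->.
Qed.

(** Transposing [x] with its neighbour in the list moves it by one place. *)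
Lemma card_ranked_insert_eq i x l :
  (i <= size l)%N -> uniq l -> x \notin l ->
  #|[pred r | ranked_as (insert i x l) r]| = #|[pred r | ranked_as (x :: l) r]|.
Proof.
move=> + ul xl; elim: i => [|i IHi] il; first by rewrite /insert take0 drop0.
rewrite -IHi ?(ltnW il)// -(card_ranked_map (tperm x (nth x l i))).
have -> // : [seq tperm x (nth x l i) z | z <- insert i.+1 x l] = insert i x l.
rewrite /insert (take_nth x) // map_cat map_rcons /= tpermL tpermR cat_rcons.
rewrite (drop_nth x il).
have id1 s : {subset s <= l} -> nth x l i \notin s -> map (tperm x (nth x l i)) s = s.
  move=> sl ys; apply: map_id_in => z zs; rewrite tpermD //.
    by apply: contraNneq xl => ->; apply: sl.
  by apply: contraNneq ys => ->.
move: ul; rewrite -{1}(cat_take_drop i l) (drop_nth x il) cat_uniq.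
move=> /and3P[_ /= /norP[ni _] /andP[ni' _]].
rewrite !id1 // => z; first exact: mem_drop.
exact: mem_take.
Qed.

Lemma ranked_insert i x l r : (i <= size l)%N -> x \notin l ->
  ranked_as (insert i x l) r = ranked_as l r && (position l x r == i).
Proof.
rewrite /ranked_as /position; elim: l i => [|y l IHl] i.
  by rewrite leqn0 => /eqP ->.
have tr := ltn_trans.
case: i => [|i]; rewrite /insert /= => il.
  rewrite inE negb_or => /andP[xy xl].
  have [ryx|rxy] /= := ltnP (r y) (r x).
    by rewrite add1n andbF ltnNge (ltnW ryx).
  have rxy' : (r x < r y)%N.
    rewrite ltn_neqAle rxy andbT; apply: contraNneq xy => /val_inj/perm_inj -> //.
  rewrite rxy' add0n /= [RHS]andbC; symmetry.
  case: (boolP (path ltn (val (r y)) [seq val (r z) | z <- l])) => pyl;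
    rewrite ?andbF ?andbT //=.
  move: pyl; rewrite path_sortedE // => /andP[/allP hall _].
  apply/eqP; apply/eqP; rewrite -leqn0 leqNgt -has_count; apply/hasPn => z zl.
  rewrite -leqNgt ltnW // (ltn_trans rxy') //.
  by apply: hall; apply: (map_f (fun z => val (r z))).
rewrite inE negb_or => /andP[_ xl].
have -> : take i l ++ x :: drop i l = insert i x l by [].
rewrite !(path_sortedE tr) IHl // !all_map (perm_all _ (perm_insert i x l)) /=.
have [ryx|rxy] /= := ltnP (r y) (r x).
  by rewrite add1n eqSS -!andbA.
rewrite add0n; symmetry; apply/negP => /andP[/andP[/allP hall _] /eqP ci].
have : has (fun z => r z < r x)%N l by rewrite has_count ci.
case/hasP => z /hall /= ryz rzx.
by have := ltn_trans ryz rzx; rewrite ltnNge rxy.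
Qed.

(** The rank of a newcomer among those already compared is uniform, whence the acceptance
    probability 1/(k+1). *)
Lemma card_ranked_insert i x l :
  (i <= size l)%N -> uniq l -> x \notin l ->
  (#|[pred r | ranked_as (insert i x l) r]| * (size l).+1)%N
  = #|[pred r | ranked_as l r]|.
Proof.
move=> il ul xl.
have -> : #|[pred r | ranked_as l r]| =
    (\sum_(j < (size l).+1) #|[pred r | ranked_as (insert j x l) r]|)%N.
  rewrite -sum1_card (partition_big
    (fun r : 'S_n => (inord (position l x r) : 'I_(size l).+1)) xpredT) //=.
  apply: eq_bigr => j _; rewrite -sum1_card; apply: eq_bigl => r.
  rewrite !inE ranked_insert //; last by rewrite -ltnS.
  by congr (_ && _); rewrite -val_eqE /= inordK // ltnS /position count_size.
rewrite (eq_bigr (fun=> #|[pred r | ranked_as (insert i x l) r]|)) => [|j _].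
  by rewrite sum_nat_const card_ord mulnC.
by rewrite !card_ranked_insert_eq // -ltnS.
Qed.

End PartialLists.

(** * Deferred decisions *)

Section Knowledge.
Variable n : nat.
Implicit Types (g b : 'I_n) (P : profile n).

(* What has been revealed: [props s g] is the exact beginning of the list of the
   girl [g]; [recv s b] holds the girls who have proposed to the boy [b], sorted
   by his ranking, so that its head is the girl he holds. *)
Record state := State {
  props : 'I_n -> seq 'I_n;
  recv : 'I_n -> seq 'I_n
}.
Implicit Type s : state.

Definition consistent s P : bool :=
  [forall b, ranked_as (recv s b) (P.1 b)] &&
  [forall g, starts_with (props s g) (P.2 g)].

(* [i] is the rank of [g] among the girls who have proposed to [b]: she is
   accepted iff [i = 0]. *)
Definition propose s g b i : state :=
  State (fun h => if h == g then rcons (props s g) b else props s h)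
        (fun c => if c == b then insert i g (recv s b) else recv s c).

Lemma consistent_propose s g b i P :
  g \notin recv s b -> (i <= size (recv s b))%N ->
  consistent (propose s g b i) P =
  [&& consistent s P, P.2 g b == size (props s g) :> nat
    & position (recv s b) g (P.1 b) == i].
Proof.
move=> gb il; apply/idP/idP.
  case/andP => /forallP /= Hb /forallP /= Hg.
  have := Hb b; rewrite eqxx ranked_insert // => /andP[rb ->].
  have := Hg g; rewrite eqxx starts_with_rcons => /andP[sg ->].
  rewrite !andbT; apply/andP; split; apply/forallP => x.
    by have := Hb x; case: eqP => [->|].
  by have := Hg x; case: eqP => [->|].
case/and3P => /andP[/forallP Hb /forallP Hg] pg pb.
apply/andP; split; apply/forallP => x /=; case: eqP => // ->.
  by rewrite ranked_insert // Hb.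
by rewrite starts_with_rcons Hg.
Qed.

Definition weight s := #|[pred P | consistent s P]|.

(** Each condition in [consistent] concerns a single ranking, so the count factorises: independence
    of the rankings in counting form. *)
Lemma weightE s : weight s =
  ((\prod_b #|[pred r : 'S_n | ranked_as (recv s b) r]|) *
   (\prod_g #|[pred r : 'S_n | starts_with (props s g) r]|))%N.
Proof.
have cfam (A : 'I_n -> pred 'S_n) :
    #|[pred f : {ffun 'I_n -> 'S_n} | [forall x, A x (f x)]]| = (\prod_x #|A x|)%N.
  transitivity #|family A|; first by apply: eq_card.
  rewrite card_family foldrE /= big_map.
  by rewrite -[RHS](big_map id xpredT (fun x => #|A x|)) map_id /index_enum enumT.
rewrite -!cfam -cardX; apply: eq_card => -[P1 P2].
by rewrite !inE.
Qed.

Lemma weight_propose s g b i :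
  uniq (props s g) -> b \notin props s g ->
  uniq (recv s b) -> g \notin recv s b -> (i <= size (recv s b))%N ->
  (weight (propose s g b i) * ((n - size (props s g)) * (size (recv s b)).+1))%N
  = weight s.
Proof.
move=> ug bg ub gb ib; rewrite !weightE.
rewrite (bigD1 b) //= (bigD1 g (F := fun h => #|[pred r | starts_with (props s h) r]|)) //=.
rewrite [in RHS](bigD1 b) //= [X in (_ * X * _)%N = _](bigD1 g) //= !eqxx.
rewrite -(card_ranked_insert ib ub gb) -(card_starts_rcons ug bg).
rewrite (eq_bigr (fun c => #|[pred r | ranked_as (recv s c) r]|)); last first.
  by move=> c /negPf ->.
rewrite [X in (_ * (_ * X) * _)%N = _](eq_bigr (fun c => #|[pred r | starts_with (props s c) r]|));
  last by move=> c /negPf ->.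
set A := #|_|; set B := #|_|; set C := (\prod_(_ < _ | _) _)%N.
set D := (\prod_(_ < _ | _) _)%N; set N := (n - _)%N; set K := (size _).+1.
by ring.
Qed.

Section Expectation.
Variable R : realFieldType.
Implicit Types f : profile n -> R.

(* Conditional expectation given [s]; it is [0] if no profile is consistent with [s]. *)
Definition cexp s f : R := (\sum_(P | consistent s P) f P) / (weight s)%:R.

Definition accept_prob s b : R := ((size (recv s b)).+1%:R)^-1.

(** One-step expectation when [g] proposes. All rejecting ranks share the value [B b], so only
    acceptance or rejection is remembered. *)
Definition average s g (A B : 'I_n -> R) : R :=
  (n - size (props s g))%:R^-1 *
  \sum_(b | b \notin props s g)
     (accept_prob s b * A b + (1 - accept_prob s b) * B b).

Lemma sum_consistent s g f : (size (props s g) < n)%N ->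
  (forall b, b \notin props s g -> g \notin recv s b) ->
  \sum_(P | consistent s P) f P =
  \sum_(b | b \notin props s g) \sum_(i < (size (recv s b)).+1)
     \sum_(P | consistent (propose s g b i) P) f P.
Proof.
move=> ltn gP.
rewrite (partition_big (fun P : profile n => ((P.2 g)^-1)%g (Ordinal ltn))
    (fun b => b \notin props s g)) /=; last first.
  move=> P /andP[_ /forallP/(_ g) sg].
  by apply: starts_with_notin sg _; rewrite permKV.
apply: eq_bigr => b bg.
rewrite (partition_big (fun P : profile n =>
   (inord (position (recv s b) g (P.1 b)) : 'I_(size (recv s b)).+1)) xpredT) //=.
apply: eq_bigr => i _; apply: eq_bigl => P.
rewrite consistent_propose ?gP -1?ltnS // -andbA; congr (_ && (_ && _)).
  apply/eqP/eqP => [<-|pb]; first by rewrite permKV.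
  by rewrite -[RHS](permK (P.2 g)); congr (_ _); apply: val_inj.
by rewrite -val_eqE /= inordK // ltnS /position count_size.
Qed.

Lemma cexp_step s g f : (size (props s g) < n)%N ->
  uniq (props s g) ->
  (forall b, b \notin props s g -> g \notin recv s b) ->
  (forall b, uniq (recv s b)) ->
  cexp s f = (n - size (props s g))%:R^-1 *
  \sum_(b | b \notin props s g) accept_prob s b *
    \sum_(i < (size (recv s b)).+1) cexp (propose s g b i) f.
Proof.
move=> ltn ug gP ub; rewrite /cexp (sum_consistent _ ltn gP) mulr_suml mulr_sumr.
apply: eq_bigr => b bg; rewrite mulr_suml mulrA mulr_sumr.
apply: eq_bigr => i _; rewrite -(weight_propose (i := i) ug bg (ub b) (gP b bg)) -1?ltnS //.
rewrite /accept_prob !natrM !invfM.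
by rewrite [RHS]mulrC -!mulrA; congr (_ * _); congr (_ * _).
Qed.

Lemma accept_prob_gt0 s b : 0 < accept_prob s b.
Proof. by rewrite invr_gt0 ltr0n. Qed.

Lemma accept_prob_le1 s b : accept_prob s b <= 1.
Proof. by rewrite invf_le1 ?ltr0n // ler1n. Qed.

(** Of the k+1 equally likely ranks of [g] at a boy with k proposals, rank 0 is the acceptance and
    the k others together have probability [1 - accept_prob]. *)
Lemma cexp_step_le s g f (A B : 'I_n -> R) : (size (props s g) < n)%N ->
  uniq (props s g) ->
  (forall b, b \notin props s g -> g \notin recv s b) ->
  (forall b, uniq (recv s b)) ->
  (forall b, b \notin props s g -> cexp (propose s g b 0) f <= A b) ->
  (forall b i, b \notin props s g -> (0 < i <= size (recv s b))%N ->
     cexp (propose s g b i) f <= B b) ->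
  cexp s f <= average s g A B.
Proof.
move=> ltn ug gP ub hA hB; rewrite (cexp_step f ltn ug gP ub) /average.
rewrite ler_wpM2l ?invr_ge0 ?ler0n //; apply: ler_sum => b bg.
rewrite big_ord_recl mulrDr lerD //.
  by apply: ler_wpM2l; [exact/ltW/accept_prob_gt0 | exact: hA].
have -> : 1 - accept_prob s b = accept_prob s b * (size (recv s b))%:R.
  rewrite /accept_prob; set k := size _.
  by rewrite -natr1; field; rewrite natr1 pnatr_eq0.
rewrite -mulrA; apply: ler_wpM2l; first exact/ltW/accept_prob_gt0.
apply: (le_trans (ler_sum _ (fun i _ => hB b (lift ord0 i) bg _))).
  by move=> i _; rewrite lift0 /=.
by rewrite sumr_const card_ord mulr_natl.
Qed.

Lemma average_add s g (A B A' B' : 'I_n -> R) :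
  average s g (fun b => A b + A' b) (fun b => B b + B' b)
  = average s g A B + average s g A' B'.
Proof.
rewrite /average -mulrDr -big_split; congr (_ * _).
by apply: eq_bigr => b _ /=; ring.
Qed.

Lemma averageZ s g c (A B : 'I_n -> R) :
  average s g (fun b => c * A b) (fun b => c * B b) = c * average s g A B.
Proof.
rewrite /average mulrCA; congr (_ * _); rewrite mulr_sumr.
by apply: eq_bigr => b _; ring.
Qed.

Lemma average_le s g (A B A' B' : 'I_n -> R) :
  (forall b, b \notin props s g -> A b <= A' b) ->
  (forall b, b \notin props s g -> B b <= B' b) ->
  average s g A B <= average s g A' B'.
Proof.
move=> hA hB; rewrite /average ler_wpM2l ?invr_ge0 ?ler0n //.
apply: ler_sum => b bg; rewrite lerD // ler_wpM2l ?hA ?hB //.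
  exact/ltW/accept_prob_gt0.
by rewrite subr_ge0 accept_prob_le1.
Qed.

Lemma average_cst s g c : uniq (props s g) -> (size (props s g) < n)%N ->
  average s g (fun=> c) (fun=> c) = c.
Proof.
move=> ug ltn; rewrite /average (eq_bigr (fun=> c)) => [|b _]; last by ring.
by rewrite sumr_const card_notin // -[c *+ _]mulr_natl mulKf // pnatr_eq0 subn_eq0 -ltnNge.
Qed.

(** The condition [0 <= c] accounts for the default value 0 at states without consistent
    profiles. *)
Lemma cexp_le s f c : 0 <= c -> (forall P, consistent s P -> f P <= c) -> cexp s f <= c.
Proof.
move=> c0 fc; have [w0|wp] := posnP (weight s).
  by rewrite /cexp w0 invr0 mulr0.
rewrite /cexp ler_pdivrMr ?ltr0n //.
by apply: (le_trans (ler_sum _ fc)); rewrite sumr_const mulr_natr.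
Qed.

Lemma cexp_cst s f c : (0 < weight s)%N -> (forall P, consistent s P -> f P = c) ->
  cexp s f = c.
Proof.
move=> wp fc; rewrite /cexp (eq_bigr (fun=> c)) // sumr_const.
by rewrite -[_ *+ _]mulr_natr mulfK // pnatr_eq0 -lt0n.
Qed.

Lemma cexp_mono s f f' : (forall P, consistent s P -> f P <= f' P) ->
  cexp s f <= cexp s f'.
Proof. by move=> ff; rewrite ler_wpM2r ?invr_ge0 ?ler0n //; apply: ler_sum. Qed.

Lemma cexpN s f : cexp s (fun P => - f P) = - cexp s f.
Proof. by rewrite /cexp sumrN mulNr. Qed.

Lemma cexpD s f f' : cexp s (fun P => f P + f' P) = cexp s f + cexp s f'.
Proof. by rewrite /cexp big_split mulrDl. Qed.

Lemma cexpZ s c f : cexp s (fun P => c * f P) = c * cexp s f.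
Proof. by rewrite /cexp -mulr_sumr mulrA. Qed.

Lemma cexp_sum s (J : Type) (r : seq J) (Q : pred J) (F : J -> profile n -> R) :
  cexp s (fun P => \sum_(j <- r | Q j) F j P) = \sum_(j <- r | Q j) cexp s (F j).
Proof. by rewrite /cexp exchange_big mulr_suml. Qed.

End Expectation.
End Knowledge.

(** * Rotations exposed at the girl-optimal matching *)

Section Rotations.
Variable n : nat.
Implicit Types (P : profile n) (mu nu : matching n) (g : 'I_n) (b : 'I_n).

Lemma girl_prefers_total P g b1 b2 :
  b1 != b2 -> ~~ girl_prefers P g b1 b2 -> girl_prefers P g b2 b1.
Proof.
rewrite /girl_prefers -leqNgt leq_eqVlt => b12 /orP[/eqP/val_inj/perm_inj b21|//].
by rewrite b21 eqxx in b12.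
Qed.

Lemma boy_prefers_total P b g1 g2 :
  g1 != g2 -> ~~ boy_prefers P b g1 g2 -> boy_prefers P b g2 g1.
Proof.
rewrite /boy_prefers -leqNgt leq_eqVlt => b12 /orP[/eqP/val_inj/perm_inj b21|//].
by rewrite b21 eqxx in b12.
Qed.

Lemma stableP P nu :
  reflect (forall b g, boy_prefers P b g (nu b) ->
             ~~ girl_prefers P g b ((nu^-1)%g g)) (stable P nu).
Proof.
apply: (iffP idP) => [st b g bp|st].
  apply: contra st => gp; apply/existsP; exists b; apply/existsP; exists g.
  by rewrite [X in X && _]bp.
apply/negP => /existsP[b /existsP[g /andP[bp gp]]].
by move: (st b g bp); rewrite [X in ~~ X]gp.
Qed.

Definition improving P mu g b : bool :=
  girl_prefers P g (boy_of mu g) b && boy_prefers P b g (girl_of mu b).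

Definition first_improving P mu g b : bool :=
  improving P mu g b && [forall b', improving P mu g b' ==> (P.2 g b <= P.2 g b')%N].

(* The cycles of [succ] of length at least 2 are the rotations exposed at [mu];
   a girl whom no further boy would accept is a fixed point. *)
Definition succ P mu g : 'I_n :=
  if [pick b | first_improving P mu g b] is Some b then girl_of mu b else g.

Lemma first_improving_inj P mu g b b' :
  first_improving P mu g b -> first_improving P mu g b' -> b = b'.
Proof.
move=> /andP[ib /forallP mb] /andP[ib' /forallP mb'].
apply: (@perm_inj _ (P.2 g)); apply: val_inj; apply/eqP; rewrite eqn_leq.
by rewrite (implyP (mb b') ib') (implyP (mb' b) ib).
Qed.

Lemma succE P mu g b : first_improving P mu g b -> succ P mu g = mu b.
Proof.
rewrite /succ => fb; case: pickP => [b' fb'|/(_ b)]; last by rewrite fb.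
by rewrite (first_improving_inj fb fb').
Qed.

Lemma improving_first P mu g b :
  improving P mu g b -> exists b', first_improving P mu g b'.
Proof.
move=> ib; case: (arg_minnP (fun b => P.2 g b) ib) => b' ib' mb'.
exists b'; rewrite /first_improving ib'; apply/forallP => c; apply/implyP => ic.
exact: mb'.
Qed.

Lemma first_improving_neq P mu g b : first_improving P mu g b -> mu b != g.
Proof.
move=> /andP[/andP[gp _] _]; apply/eqP => mb.
by move: gp; rewrite /girl_prefers /boy_of -mb permK ltnn.
Qed.

Lemma succ_neq P mu g : succ P mu g != g ->
  exists2 b, first_improving P mu g b & succ P mu g = mu b.
Proof.
rewrite /succ; case: pickP => [b fb _|]; last by rewrite eqxx.
by exists b.
Qed.

Section Minimum.
Variables (P : profile n) (mu : matching n).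
Hypothesis mu_min : is_minimum P (stable_matchings P) mu.
Let s := succ P mu.

Lemma minimum_stable : stable P mu.
Proof. by case/andP: mu_min; rewrite inE. Qed.

Lemma minimum_boys nu b : stable P nu -> nu b != mu b -> boy_prefers P b (nu b) (mu b).
Proof.
move=> st nb; case/andP: mu_min => _ /forallP/(_ nu)/implyP.
by rewrite inE st => /(_ isT)/forallP/(_ b) /orP[/eqP/eqP|//]; rewrite (negPf nb).
Qed.

(** Otherwise [g] prefers her partner in [nu], who by minimality prefers her to his partner in [mu];
    the two would block [mu]. *)
Lemma minimum_girls nu g : stable P nu -> boy_of nu g != boy_of mu g ->
  girl_prefers P g (boy_of mu g) (boy_of nu g).
Proof.
rewrite /boy_of => st ng; apply: contraT => gp.
have gp' := girl_prefers_total _ gp; rewrite eq_sym in gp'.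
have b2 : nu ((nu^-1)%g g) != mu ((nu^-1)%g g).
  rewrite permKV; apply: contra ng => /eqP gE.
  by rewrite [X in _ == (mu^-1)%g X]gE permK.
have := minimum_boys st b2; rewrite {1}permKV => bp.
by have := stableP _ _ minimum_stable _ _ bp; rewrite gp'.
Qed.

Lemma minimum_best g : best_stable_partner P g (boy_of mu g).
Proof.
apply/andP; split.
  by apply/existsP; exists mu; rewrite inE minimum_stable eqxx.
apply/forallP => b; apply/implyP => /existsP[nu /andP[]].
rewrite inE => st /eqP <-; apply/implyP; exact: minimum_girls.
Qed.

Lemma best_minimum nu g : stable P nu ->
  best_stable_partner P g (boy_of nu g) = (boy_of nu g == boy_of mu g).
Proof.
move=> st; apply/idP/eqP => [|->]; last exact: minimum_best.
case/andP => _ /forallP/(_ (boy_of mu g)); have [//|neq] := eqVneq (boy_of nu g) (boy_of mu g).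
have /andP[-> _] /= := minimum_best g.
have := minimum_girls st neq; rewrite /girl_prefers => lt1 lt2.
by have := ltn_trans lt1 lt2; rewrite ltnn.
Qed.

(** Best stable-partners are the partners in [mu], so the matchings for [F] are the stable ones
    agreeing with [mu] on [F]. As [mu] lies below all of them, it is their maximum only if it is
    alone. *)
Lemma winningP (F : {set 'I_n}) : reflect
  (forall nu, stable P nu -> {in F, forall g, boy_of nu g = boy_of mu g} -> nu = mu)
  (winning_coalition P F).
Proof.
have inM nu : (nu \in stable_best_for P F) =
    stable P nu && [forall g in F, boy_of nu g == boy_of mu g].
  rewrite !inE; have [st|//] /= := boolP (stable P nu).
  by apply: eq_forallb => g; rewrite best_minimum.
have anti nu1 nu2 : matching_ge P nu1 nu2 -> matching_ge P nu2 nu1 -> nu1 = nu2.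
  move=> /forallP h1 /forallP h2; apply/permP => b.
  have /orP[/eqP //|lt1] := h1 b; have /orP[/eqP //|lt2] := h2 b.
  by have := ltn_trans lt1 lt2; rewrite ltnn.
have muM : mu \in stable_best_for P F.
  by rewrite inM minimum_stable /=; apply/forallP => g; apply/implyP.
apply: (iffP idP) => [|h].
  case/existsP => mu' /andP[/andP[mu'M /forallP mmax] /andP[mu'S /forallP mmin]].
  have mu'E : mu' = mu.
    apply: anti; first by have := mmax mu; rewrite muM.
    by have := mmin mu; rewrite inE minimum_stable.
  move=> nu st nuF; apply: anti.
    case/andP: mu_min => _ /forallP/(_ nu); by rewrite inE st.
  have := mmax nu; rewrite inM st mu'E /= => /implyP; apply.
  by apply/forallP => g; apply/implyP => /nuF ->.
apply/existsP; exists mu; rewrite mu_min andbT; apply/andP; split => //.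
apply/forallP => nu; apply/implyP; rewrite inM => /andP[st /forallP nuF].
rewrite (h nu) //; last by move=> g gF; apply/eqP; have := nuF g; rewrite gF.
by apply/forallP => b; rewrite eqxx.
Qed.

Definition cyclic : {set 'I_n} := [set g | (s g != g) && fconnect s (s g) g].
Definition cycle_of g : {set 'I_n} := [set x | fconnect s g x].
Definition cycles : {set {set 'I_n}} := [set cycle_of g | g in cyclic].

Lemma cycle_ofP g x : g \in cyclic -> x \in cycle_of g ->
  (x \in cyclic) && (cycle_of x == cycle_of g).
Proof.
rewrite !inE => /andP[sg cg] /iter_findex <-; set k := findex _ _ _.
have step y : (s y != y) && fconnect s (s y) y ->
    ((s (s y) != s y) && fconnect s (s (s y)) (s y)) && (cycle_of (s y) == cycle_of y).
  move=> /andP[sy cy].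
  have same : cycle_of (s y) == cycle_of y.
    apply/eqP/setP => z; rewrite !inE; apply/idP/idP => h.
      exact: connect_trans (fconnect1 s y) h.
    exact: connect_trans cy h.
  rewrite same andbT; apply/andP; split.
    apply: contra sy => /eqP ssy; have := iter_findex cy.
    suff -> : iter (findex s (s y) y) s (s y) = s y by move=> {2}<-.
    by elim: (findex _ _ _) => //= j ->.
  have /setP/(_ (s y)) : cycle_of (s (s y)) = cycle_of (s y); last first.
    by rewrite !inE connect0.
  apply/setP => z; rewrite !inE; apply/idP/idP => h.
    exact: connect_trans (fconnect1 s (s y)) h.
  apply: connect_trans (connect_trans _ (fconnect1 s y)) _; last exact: h.
  have := iter_findex cy; case: (findex s (s y) y) => [/= sy'|j].
    by rewrite sy' eqxx in sy.
  by rewrite iterSr => yE; rewrite -[X in connect _ _ X]yE; apply: fconnect_iter.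
elim: k => [|k IHk]; first by rewrite /= sg cg eqxx.
case/andP: IHk => /step /andP[h1 /eqP h2] /eqP h3.
by rewrite iterS h1 h2 h3 eqxx.
Qed.

Lemma cycle_of_inj g : g \in cyclic -> {in cycle_of g &, injective s}.
Proof.
(* The implication used: if [g] is reachable from [s g], then [s] is injective on the orbit of
   [g]. *)
rewrite inE => /andP[_ /(orbitPcycle 2 5) inj] y z.
by rewrite !inE !fconnect_orbit; apply: inj.
Qed.

Lemma succ_cycle_of g x : x \in cycle_of g -> s x \in cycle_of g.
Proof. by rewrite !inE => h; apply: connect_trans h (fconnect1 s x). Qed.

(** If [F] missed a cycle, eliminating that rotation (each of its girls moves to her first improving
    boy) would give another stable matching agreeing with [mu] on [F]. *)
Lemma winning_hits (F : {set 'I_n}) g : winning_coalition P F -> g \in cyclic ->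
  exists2 x, x \in F & x \in cycle_of g.
Proof.
move=> /winningP win cg; apply/exists_inP; apply: contraT => /exists_inPn noF.
pose O := cycle_of g; pose h x := if x \in O then s x else x.
have h_inj : injective h.
  move=> x y; rewrite /h; case: ifP => xO; case: ifP => yO // hxy.
  - exact: (cycle_of_inj cg).
  - by move: yO; rewrite -hxy succ_cycle_of.
  - by move: xO; rewrite hxy succ_cycle_of.
pose nu : matching n := (perm h_inj * mu^-1)^-1%g.
have nuV x : (nu^-1)%g x = (mu^-1)%g (h x) by rewrite /nu invgK permM; congr (_ _); rewrite permE.
have first x : x \in O -> exists2 b, first_improving P mu x b & s x = mu b.
  move=> xO; have /andP[] := cycle_ofP cg xO; rewrite inE => /andP[sx _] _.
  exact: succ_neq.
(* No boy loses by the rotation, so a pair blocking [nu] has a boy who also prefers the girl to his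
   partner in [mu]. *)
have improve b x : boy_prefers P b x (nu b) -> boy_prefers P b x (mu b).
  move=> bp; set y := nu b in bp.
  have hy : h y = mu b.
    by have := nuV y; rewrite {1}/y permK => /(congr1 mu); rewrite permKV.
  move: hy; rewrite /h; case: ifP => [yO|_ <- //].
  have [c fc ->] := first _ yO; move=> /perm_inj cb; rewrite cb in fc.
  case/andP: fc => /andP[_ yb] _; exact: ltn_trans bp yb.
suff st : stable P nu.
  have /(congr1 (fun m : matching n => (m^-1)%g g)) : nu = mu.
    apply: win => // x xF; rewrite /boy_of nuV /h ifN //; exact: noF.
  have gO : g \in O by rewrite inE connect0.
  rewrite nuV /h gO => /perm_inj sg.
  by move: cg; rewrite inE sg eqxx.
apply/stableP => b x bp; apply/negP => xp; have bp' := improve _ _ bp.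
(* Stability of [mu] puts [b] below the [mu]-partner of [x]. If [x] is on the cycle, [b] would then
   be an improving boy ranked before her first one. *)
have muxp := stableP _ _ minimum_stable _ _ bp'.
move: xp; rewrite nuV /h; case: ifP => [xO|_ xp]; last by rewrite xp in muxp.
have [c fc ->] := first _ xO; rewrite permK => xp.
have bneq : b != (mu^-1)%g x.
  by apply/eqP => bE; move: bp'; rewrite bE permKV /boy_prefers ltnn.
have ib : improving P mu x b.
  by rewrite /improving [X in _ && X]bp' andbT; exact: girl_prefers_total muxp.
case/andP: fc => _ /forallP/(_ b); rewrite ib leqNgt.
by rewrite -/(girl_prefers P x b c) xp.
Qed.

(** For a stable [nu] other than [mu], [succ] moves every girl whose partners differ and keeps her
    in that set [D]. Hence [D] contains a whole cycle, which [F] meets although [nu] agrees with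
    [mu] on [F]. *)
Lemma hits_winning (F : {set 'I_n}) :
  (forall g, g \in cyclic -> exists2 x, x \in F & x \in cycle_of g) ->
  winning_coalition P F.
Proof.
move=> hit; apply/winningP => nu st nuF; apply/eqP/contraT => neq.
pose D := [pred g | (nu^-1)%g g != (mu^-1)%g g].
have Dsucc g : g \in D -> (s g != g) && (s g \in D).
  rewrite inE => gD; set b' := (nu^-1)%g g.
  have nub' : nu b' = g by rewrite permKV.
  have better c : nu c != mu c -> mu c \in D.
    by rewrite inE permK; apply: contra => /eqP {1}<-; rewrite permKV.
  have ib' : improving P mu g b'.
    apply/andP; split; first exact: minimum_girls.
    rewrite -{1}nub'; apply: minimum_boys => //; rewrite nub'.
    by apply: contra gD => /eqP gE; rewrite [X in _ == (mu^-1)%g X]gE permK.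
  have [b fb] := improving_first ib'.
  rewrite /s (succE fb) (first_improving_neq fb) better //.
  have [->|bb'] := eqVneq b b'.
    rewrite nub'; apply: contra gD => /eqP gE.
    by rewrite [X in _ == (mu^-1)%g X]gE permK.
  (* Here [g] prefers [b] to her partner [b'] in [nu], so by stability [b] does not prefer [g] to
     [nu b]. He does prefer her to [mu b], so the two differ. *)
  case/andP: fb => /andP[_ bp] /forallP/(_ b'); rewrite ib' /= => gb.
  have gp : girl_prefers P g b b'.
    rewrite /girl_prefers ltn_neqAle gb andbT; apply: contra bb' => /eqP rE.
    by apply/eqP/(@perm_inj _ (P.2 g))/val_inj.
  apply: contraTneq bp => nb; rewrite /girl_of -nb; apply: contraL gp; exact: stableP.
have Diter g k : g \in D -> iter k s g \in D.
  by move=> gD; elim: k => //= k /Dsucc/andP[].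
have [g gD] : exists g, g \in D.
  apply/existsP; apply: contraNT neq; rewrite negb_exists => /forallP nD.
  apply/eqP/invg_inj/permP => g; apply/eqP; have := nD g.
  by rewrite inE negbK.
(* After [order] steps the orbit of [g] is exhausted, so [x] repeats an earlier point and lies on a
   cycle. *)
pose k := fingraph.order s g; pose x := iter k s g.
have xD : x \in D by apply: Diter.
have : x \in traject s g k by rewrite -/(fingraph.orbit s g) -fconnect_orbit fconnect_iter.
case/trajectP => i ik xE.
have cx : x \in cyclic.
  rewrite inE; case/andP: (Dsucc _ xD) => -> _ /=.
  apply/(orbitPcycle 3 2); exists (k - i).-1.
  by rewrite prednK ?subn_gt0 // {1}xE -iterD subnK // ltnW.
have [y yF yO] := hit _ cx.
have yD : y \in D.
  by move: yO; rewrite inE => /iter_findex <-; apply: Diter.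
by move: yD; rewrite inE -/(boy_of nu y) nuF // eqxx.
Qed.

Lemma cycles_trivIset : finset.trivIset cycles.
Proof.
apply/finset.trivIsetP => A B /imsetP[x cx ->] /imsetP[y cy ->] neq.
rewrite -finset.setI_eq0; apply: contraNT neq => /finset.set0Pn[z /finset.setIP[zx zy]].
have /andP[_ /eqP <-] := cycle_ofP cx zx.
by have /andP[_ /eqP <-] := cycle_ofP cy zy.
Qed.

Lemma cover_cycles : finset.cover cycles = cyclic.
Proof.
apply/setP => x; apply/finset.bigcupP/idP => [[A /imsetP[g cg ->] xA]|cx].
  by case/andP: (cycle_ofP cg xA).
by exists (cycle_of x); [apply: imset_f | rewrite inE connect0].
Qed.

Lemma card_minimum_winning (F : {set 'I_n}) : minimum_winning_coalition P F ->
  #|F| = #|cycles|.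
Proof.
move=> [winF minF]; apply/eqP; rewrite eqn_leq; apply/andP; split.
  have part : finset.partition cycles (finset.cover cycles).
    rewrite /finset.partition eqxx cycles_trivIset /=; apply/imsetP => -[x _ /setP/(_ x)].
    by rewrite !inE connect0.
  rewrite -(card_transversal (transversalP part)); apply: minF.
  apply: hits_winning => g cg.
  have gA : cycle_of g \in cycles by apply: imset_f.
  have /setP/(_ (transversal_repr g (transversal cycles (finset.cover cycles)) (cycle_of g)))
    := setI_transversal_pblock (transversalP part) g gA.
  rewrite !inE eqxx => /andP[h1 h2]; eexists; first exact: h1.
  by rewrite inE.
have tr : (\sum_(A in cycles) #|F :&: A| <= #|F|)%N.
  rewrite (eq_bigr (fun A : {set 'I_n} => \sum_(x in A) (x \in F : nat))%N); last first.
    move=> A _; rewrite -sum1_card [RHS]big_mkcond [LHS]big_mkcond /=.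
    by apply: eq_bigr => x _; rewrite inE andbC; case: (x \in A); case: (x \in F).
  rewrite -finset.big_trivIset ?cycles_trivIset // -sum1_card [X in (_ <= X)%N]big_mkcond.
  rewrite [X in (X <= _)%N]big_mkcond /=.
  by apply: leq_sum => x _; do 2! case: ifP.
apply: leq_trans tr; rewrite -sum1_card; apply: leq_sum => A /imsetP[g cg ->].
have [x xF xO] := winning_hits winF cg.
by rewrite card_gt0; apply/finset.set0Pn; exists x; apply/finset.setIP.
Qed.

Lemma card_cyclesE (R : numFieldType) :
  #|cycles|%:R = \sum_(g in cyclic) (fingraph.order s g)%:R^-1 :> R.
Proof.
rewrite -cover_cycles finset.big_trivIset ?cycles_trivIset //.
rewrite -sum1_card natr_sum; apply: eq_bigr => A /imsetP[g cg ->].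
have ord x : fingraph.order s x = #|cycle_of x|.
  by apply: eq_card => y; rewrite !inE.
rewrite (eq_bigr (fun=> (#|cycle_of g|%:R^-1))); last first.
  by move=> x xg; have /andP[_ /eqP <-] := cycle_ofP cg xg; rewrite ord.
rewrite sumr_const -[_^-1 *+ _]mulr_natl mulfV // pnatr_eq0 -lt0n card_gt0.
by apply/finset.set0Pn; exists g; rewrite inE connect0.
Qed.

End Minimum.

Definition period P mu k g : bool :=
  uniq (traject (succ P mu) g k) && (iter k (succ P mu) g == g).

(** * Counting cycles by their length *)

Section Periods.
Variables (P : profile n) (mu : matching n).
Let s := succ P mu.

Lemma period_cyclic k g : (1 < k)%N ->
  period P mu k g = (g \in cyclic P mu) && (fingraph.order s g == k).
Proof.
move=> k1; apply/idP/idP => [/andP[uk /eqP ik]|].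
  have gc : g \in cyclic P mu.
    rewrite inE; apply/andP; split.
      case: k k1 uk {ik} => [|[|k]] //= _; rewrite inE negb_or eq_sym.
      by case/andP => /andP[].
    by apply/(orbitPcycle 3 2); exists k.-1; rewrite prednK // ltnW.
  rewrite gc /=; rewrite -(size_traject s g k) -(card_uniqP uk).
  apply/eqP/eq_card => x; rewrite [LHS]inE; apply/idP/idP.
    move=> /iter_findex <-; move: (findex _ _ _) => j; apply/trajectP.
    exists (j %% k)%N; first by rewrite ltn_mod ltnW.
    rewrite {1}(divn_eq j k) addnC iterD; congr (iter _ _ _).
    by elim: (j %/ k)%N => // q IHq; rewrite mulSn addnC iterD ik.
  by case/trajectP => j _ ->; apply: fconnect_iter.
case/andP => gc /eqP <-; rewrite /period -/s orbit_uniq /=.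
by move: gc; rewrite inE => /andP[_ /(orbitPcycle 2 4) ->].
Qed.

Lemma sum_period_le (R : numFieldType) (K : nat) :
  \sum_(2 <= k < K) k%:R^-1 * (\sum_g (period P mu k g)%:R) <= #|cycles P mu|%:R :> R.
Proof.
rewrite card_cyclesE (eq_bigr (fun k => \sum_g k%:R^-1 * (period P mu k g)%:R));
  last by move=> k _; rewrite mulr_sumr.
rewrite exchange_big [leRHS]big_mkcond /=; apply: ler_sum => g _.
have [gc|gc] := boolP (g \in cyclic P mu); last first.
  rewrite big_nat big1 // => k /andP[k1 _].
  by rewrite period_cyclic // (negPf gc) mulr0.
rewrite big_nat (eq_bigr (fun k : nat => if k == fingraph.order s g then k%:R^-1 else 0)) =>
  [|k /andP[k1 _]]; last first.
  by rewrite period_cyclic // gc /= eq_sym; case: eqP => _; rewrite ?mulr1 ?mulr0.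
by rewrite -big_nat -big_mkcond big_nat1_eq; case: ifP; rewrite ?invr_ge0.
Qed.

(** A girl on a cycle of length at least [K] contributes at most 1 and has [K] distinct first
    iterates; the second sum pays for her. *)
Lemma sum_period_ge (R : numFieldType) (K : nat) : (1 < K)%N ->
  #|cycles P mu|%:R <= \sum_(2 <= k < K) k%:R^-1 * (\sum_g (period P mu k g)%:R)
    + \sum_g (uniq (traject s g K))%:R :> R.
Proof.
move=> K1.
rewrite card_cyclesE (eq_bigr (fun k => \sum_g k%:R^-1 * (period P mu k g)%:R));
  last by move=> k _; rewrite mulr_sumr.
rewrite exchange_big -big_split [leLHS]big_mkcond /=; apply: ler_sum => g _.
have pos : 0 <= \sum_(2 <= k < K) k%:R^-1 * (period P mu k g)%:R :> R.
  by apply: sumr_ge0 => k _; rewrite mulr_ge0 ?invr_ge0 ?ler0n.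
case: ifP => gc; last by rewrite addr_ge0.
have [ltK|geK] := ltnP (fingraph.order s g) K.
  have ord1 : (1 < fingraph.order s g)%N.
    move: gc; rewrite inE => /andP[sg _].
    rewrite /fingraph.order (cardD1 g) inE connect0 (cardD1 (s g)) !inE sg.
    by rewrite fconnect1.
  rewrite ler_wpDr // (bigD1_seq (fingraph.order s g)) ?iota_uniq //=; last first.
    by rewrite mem_index_iota ltK ord1.
  rewrite period_cyclic // gc eqxx mulr1 lerDl.
  by apply: sumr_ge0 => k _; rewrite mulr_ge0 ?invr_ge0 ?ler0n.
rewrite ler_wpDl // -(take_traject s g geK) take_uniq ?orbit_uniq //.
by rewrite invf_le1 ?ler1n ?ltr0n // /fingraph.order; apply/card_gt0P; exists g; rewrite inE connect0.
Qed.

End Periods.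
End Rotations.

(** * The girl-proposing algorithm *)

Section ProposalPhase.
Variable n : nat.
Implicit Types (g b : 'I_n) (P : profile n) (s : state n) (mu nu : matching n).

Record wf s : Prop := Wf {
  wf_weight : (0 < weight s)%N;
  wf_props : forall g, uniq (props s g);
  wf_recv : forall b, uniq (recv s b);
  wf_mem : forall g b, (g \in recv s b) = (b \in props s g)
}.

Definition head_of s b : option 'I_n := ohead (recv s b).

Lemma wf_propose s g b i : wf s -> b \notin props s g -> (i <= size (recv s b))%N ->
  wf (propose s g b i).
Proof.
move=> w bg ib; have gb : g \notin recv s b by rewrite wf_mem.
split.
- have := wf_weight w.
  rewrite -(weight_propose (wf_props w g) bg (wf_recv w b) gb ib).
  by rewrite muln_gt0 => /andP[].
- move=> h /=; case: eqP => [_|_]; last exact: wf_props.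
  by rewrite rcons_uniq bg wf_props.
- move=> c /=; case: eqP => [_|_]; last exact: wf_recv.
  by rewrite uniq_insert gb wf_recv.
move=> h c /=; have [->|cb] := eqVneq c b; have [->|hg] := eqVneq h g.
- by rewrite mem_insert mem_rcons inE !eqxx.
- by rewrite mem_insert (negPf hg) /= wf_mem.
- by rewrite mem_rcons inE (negPf cb) /= wf_mem.
- exact: wf_mem.
Qed.

Lemma consistent_wf_propose s g b i P : wf s -> b \notin props s g ->
  (i <= size (recv s b))%N -> consistent (propose s g b i) P ->
  consistent s P /\ P.2 g b = size (props s g) :> nat.
Proof.
move=> w bg ib; rewrite consistent_propose ?wf_mem // => /and3P[-> /eqP ->] //.
Qed.

Lemma head_of_propose0 s g b : head_of (propose s g b 0) b = Some g.
Proof. by rewrite /head_of /= eqxx /insert take0. Qed.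

Lemma head_of_propose s g b i : (0 < i <= size (recv s b))%N ->
  head_of (propose s g b i) b = head_of s b.
Proof.
rewrite /head_of /= eqxx /insert; case: (recv s b) => [|x l] /=; case: i => //.
Qed.

Lemma head_of_propose_neq s g b i c : c != b ->
  head_of (propose s g b i) c = head_of s c.
Proof. by rewrite /head_of /= => /negPf ->. Qed.

Lemma head_mem s b g : head_of s b = Some g -> g \in recv s b.
Proof. by rewrite /head_of; case: (recv s b) => //= x l [->]; rewrite inE eqxx. Qed.

Lemma head_best s P b g g' : consistent s P -> head_of s b = Some g ->
  g' \in recv s b -> g' != g -> boy_prefers P b g g'.
Proof.
move=> /andP[/forallP/(_ b) + _]; rewrite /ranked_as /head_of.
case: (recv s b) => //= x l + [<-].
rewrite (path_sortedE ltn_trans) inE => /andP[/allP xl _] /orP[/eqP ->|g'l _].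
  by rewrite eqxx.
by apply: xl; apply: (map_f (fun z => val (P.1 b z))).
Qed.

Lemma props_prefers s P g b b' : consistent s P ->
  b \in props s g -> b' \notin props s g -> girl_prefers P g b b'.
Proof. by move=> /andP[_ /forallP/(_ g)]; apply: starts_with_lt. Qed.

Lemma last_prefers s P g b b' : consistent s P -> uniq (props s g) ->
  last b' (props s g) = b -> b' \in props s g -> b' != b -> girl_prefers P g b' b.
Proof.
move=> /andP[_ /forallP/(_ g)]; move: (props s g) => p.
case/lastP: p => // p c; rewrite starts_with_rcons last_rcons mem_rcons rcons_uniq.
move=> /andP[sp /eqP rc] /andP[cp _] <-; rewrite inE.
by case: eqP => //= _ b'p _; apply: starts_with_lt sp _ _.
Qed.

(** [pinv_last] expresses that a girl does not propose while she is held; [pinv_reject] is the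
    Gale-Shapley invariant that a rejected pair occurs in no stable matching. *)
Record proposal_inv s : Prop := ProposalInv {
  pinv_wf : wf s;
  pinv_last : forall b g, head_of s b = Some g -> last b (props s g) = b;
  pinv_reject : forall P nu g b, consistent s P -> stable P nu ->
    b \in props s g -> head_of s b != Some g -> nu b != g
}.

Definition single s g : bool := [forall b, head_of s b != Some g].

Lemma head_of_inj s b b' g : proposal_inv s ->
  head_of s b = Some g -> head_of s b' = Some g -> b = b'.
Proof.
move=> inv hb hb'; rewrite -(pinv_last inv hb) -(pinv_last inv hb').
have := head_mem hb; rewrite (wf_mem (pinv_wf inv)).
by case: (props s g).
Qed.

(** If [b] holds [y] but [nu] gives him another girl who proposed to him, then [y] has not yet
    approached her own partner in [nu], since otherwise he would have rejected her earlier. So [y]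
    prefers [b], and the two block [nu]. *)
Lemma proposal_inv_propose s g b i : proposal_inv s -> single s g ->
  b \notin props s g -> (i <= size (recv s b))%N ->
  proposal_inv (propose s g b i).
Proof.
move=> inv /forallP sg bg ib; have w := pinv_wf inv.
have w' : wf (propose s g b i) by apply: wf_propose.
have lastP' c h : head_of (propose s g b i) c = Some h ->
    last c (props (propose s g b i) h) = c.
  move=> hc; have [hg|hg] := eqVneq h g; last first.
    have hs : head_of s c = Some h.
      have [cb|cb] := eqVneq c b; last by rewrite -hc head_of_propose_neq.
      rewrite cb in hc *; move: hc; have [->|i0] := posnP i.
        by rewrite head_of_propose0 => -[gh]; rewrite gh eqxx in hg.
      by rewrite head_of_propose // i0.
    by rewrite /= (negPf hg) (pinv_last inv hs).
  rewrite hg /= eqxx last_rcons.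
  apply/eqP/contraT => bc; move: hc; rewrite head_of_propose_neq 1?eq_sym //.
  by move/eqP; rewrite hg (negPf (sg c)).
split=> // P nu h c cP st.
have [cs rb] := consistent_wf_propose w bg ib cP.
have [->{c}|cb] := eqVneq c b; last first.
  rewrite head_of_propose_neq // => ch; apply: (pinv_reject inv cs st) => //.
  by move: ch => /=; case: eqP => // ->; rewrite mem_rcons inE (negPf cb).
move=> bh hdb; apply/eqP => nub.
have hb' : h \in recv (propose s g b i) b by rewrite (wf_mem w').
case hdE : (head_of (propose s g b i) b) => [y|]; last first.
  by move: hdE hb'; rewrite /head_of; case: (recv _ _).
have hy : h != y by apply: contraNneq hdb => ->; rewrite hdE.
have bhy := head_best cP hdE hb' hy.
pose b2 := (nu^-1)%g y.
have nub2 : nu b2 = y by rewrite permKV.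
have b2b : b2 != b by apply: contra_neq hy => b2E; rewrite -nub -b2E nub2.
have yp : b \in props (propose s g b i) y by rewrite -(wf_mem w') (head_mem hdE).
have b2p : b2 \notin props (propose s g b i) y.
  apply/negP => b2y.
  have b2s : b2 \in props s y.
    by move: b2y => /=; case: eqP => // ->; rewrite mem_rcons inE (negPf b2b).
  have : nu b2 != y; last by rewrite nub2 eqxx.
  apply: (pinv_reject inv cs st b2s); apply/eqP => hb2.
  have := lastP' b2 y; rewrite head_of_propose_neq // => /(_ hb2).
  have := lastP' b y hdE; move: yp; case: (props _ y) => //= x l _ -> b2E.
  by rewrite b2E eqxx in b2b.
have := stableP _ _ st b y; rewrite nub => /(_ bhy).
by rewrite -/b2 (props_prefers cP yp b2p).
Qed.

Definition init_state : state n := State (fun=> [::]) (fun=> [::]).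

Lemma consistent_init P : consistent init_state P.
Proof. by apply/andP; split; apply/forallP. Qed.

Lemma weight_init : weight init_state = #|{: profile n}|.
Proof. by apply: eq_card => P; rewrite !inE consistent_init. Qed.

Lemma proposal_inv_init : proposal_inv init_state.
Proof.
split=> //; split=> //.
rewrite weight_init; apply/card_gt0P.
by exists ([ffun=> 1%g], [ffun=> 1%g]).
Qed.

Lemma proposal_complete s : proposal_inv s -> (forall b, head_of s b != None) ->
  exists mu, forall b, head_of s b = Some (mu b).
Proof.
move=> inv full; have hd b : {g | head_of s b = Some g}.
  by move: (full b); case: (head_of s b) => // g _; exists g.
have hd_inj : injective (fun b => sval (hd b)).
  move=> b b' /= e; apply: (head_of_inj inv (svalP (hd b))).
  by rewrite e; exact: (svalP (hd b')).
by exists (perm hd_inj) => b; rewrite permE; exact: (svalP (hd b)).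
Qed.

Section Complete.
Variables (s : state n) (mu : matching n).
Hypothesis inv : proposal_inv s.
Hypothesis full : forall b, head_of s b = Some (mu b).

Lemma complete_mem b : mu b \in recv s b.
Proof. exact: head_mem. Qed.

Lemma complete_not_improving P g b : consistent s P -> b \in props s g ->
  ~~ girl_prefers P g (boy_of mu g) b.
Proof.
move=> cP bg; apply/negP => gp.
have neq : b != boy_of mu g.
  by apply: contraTneq gp => ->; rewrite /girl_prefers ltnn.
have hl := pinv_last inv (full (boy_of mu g)); rewrite permKV in hl.
have := last_prefers cP (wf_props (pinv_wf inv) g) _ bg neq.
have -> : last b (props s g) = boy_of mu g by move: hl bg; case: (props s g).
by move=> /(_ erefl); rewrite /girl_prefers ltnNge (ltnW gp).
Qed.

(** If [b] preferred [mu b] to his partner in a stable [nu], then [mu b] would have to prefer her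
    [nu]-partner to [b]. She would have approached him before and been rejected, contrary to
    [pinv_reject]. *)
Lemma complete_minimum P : consistent s P -> is_minimum P (stable_matchings P) mu.
Proof.
move=> cP; apply/andP; split.
  rewrite inE; apply/stableP => b g bp; apply/negP => gp.
  have : g \notin recv s b.
    apply/negP => gb; have neq : g != mu b.
      by apply: contraTneq bp => ->; rewrite /boy_prefers ltnn.
    have := head_best cP (full b) gb neq.
    by rewrite /boy_prefers ltnNge (ltnW bp).
  rewrite (wf_mem (pinv_wf inv)) => bg.
  have mg : (mu^-1)%g g \in props s g.
    by rewrite -(wf_mem (pinv_wf inv)) -{1}(permKV mu g) complete_mem.
  have := props_prefers cP mg bg.
  by rewrite /girl_prefers ltnNge (ltnW gp).
apply/forallP => nu; apply/implyP; rewrite inE => st; apply/forallP => b.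
rewrite /girl_of; have [//|neq /=] := eqVneq (nu b) (mu b).
apply: contraT => /(boy_prefers_total neq) bp.
have := stableP _ _ st _ _ bp.
rewrite (props_prefers cP (b := b)) //.
  by rewrite -(wf_mem (pinv_wf inv)) complete_mem.
apply/negP => b2p; have := pinv_reject inv cP st b2p.
rewrite permKV eqxx => h; have : ~ is_true false by []; apply; apply: h.
rewrite full; apply: contra neq => /eqP[/perm_inj b2E].
by rewrite -{1}b2E permKV.
Qed.

End Complete.
End ProposalPhase.

(** * Following [succ] by further proposals *)

Section ChainPhase.
Variables (n : nat) (mu : matching n) (g1 : 'I_n).
Implicit Types (g b : 'I_n) (P : profile n) (s : state n) (path : seq 'I_n)
  (f : pred (profile n)).

Notation b1 := (boy_of mu g1).
Definition proposer path : 'I_n := last g1 (map mu path).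

(* From the girl-optimal state, [g1] resumes proposing; every accepting boy
   outside [b1 :: path] dismisses his partner in [mu], who proposes next, and
   joins [path].  The predicate [f] is the event under study: a path boy who
   rejects a proposal may still prefer the proposer to his partner in [mu], and
   only on [f] can this be ruled out. *)
Record chain_inv f s path : Prop := ChainInv {
  cinv_wf : wf s;
  cinv_uniq : uniq (b1 :: path);
  cinv_head : forall b, b \notin path -> head_of s b = Some (mu b);
  cinv_mem : forall b, mu b \in recv s b;
  cinv_last : forall b, b \notin b1 :: path -> last b (props s (mu b)) = b;
  cinv_track : forall P, consistent s P -> f P ->
    traject (succ P mu) g1 (size path).+1 = g1 :: map mu path;
  cinv_reject : forall P b, consistent s P -> f P ->
    b \in props s (proposer path) -> ~~ improving P mu (proposer path) b
}.

Lemma proposerE path : exists2 b, b \in b1 :: path & proposer path = mu b.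
Proof.
rewrite /proposer; case/lastP: path => [|p b].
  by exists b1; rewrite ?inE ?eqxx //= permKV.
exists b; last by rewrite map_rcons last_rcons.
by rewrite inE mem_rcons inE eqxx orbT.
Qed.

Lemma mu_neq_proposer path b : b \notin b1 :: path -> mu b != proposer path.
Proof.
by move=> bp; have [c cp ->] := proposerE path; apply: contraNneq bp => /perm_inj ->.
Qed.

Lemma chain_start f s : proposal_inv s -> (forall b, head_of s b = Some (mu b)) ->
  chain_inv f s [::].
Proof.
move=> inv full; split=> //.
- exact: pinv_wf inv.
- by move=> b; apply: head_mem.
- by move=> b _; apply: (pinv_last inv).
move=> P b cP _ bg; rewrite /improving negb_and.
by rewrite (complete_not_improving inv full cP bg).
Qed.

Section Step.
Variables (f : pred (profile n)) (s : state n) (path : seq 'I_n).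
Hypothesis inv : chain_inv f s path.
Let g := proposer path.
Variable b : 'I_n.
Hypothesis bg : b \notin props s g.

Let consistent_s i P : (i <= size (recv s b))%N ->
  consistent (propose s g b i) P -> consistent s P.
Proof. by move=> ib /(consistent_wf_propose (cinv_wf inv) bg ib) []. Qed.

(** Boys approached earlier are not improving by [cinv_reject], and those not yet approached come
    after [b] in her list. *)
Lemma accept_first_improving P : consistent (propose s g b 0) P -> f P ->
  first_improving P mu g b.
Proof.
move=> cP fP; have cs := consistent_s (leq0n _) cP; have w := cinv_wf inv.
have gb : g \notin recv s b by rewrite (wf_mem w).
have mg : boy_of mu g \in props s g.
  by rewrite -(wf_mem w) -{1}(permKV mu g) (cinv_mem inv).
have bgp : b \in props (propose s g b 0) g by rewrite /= eqxx mem_rcons inE eqxx.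
rewrite /first_improving /improving (props_prefers cs mg bg) /=.
have -> /= : boy_prefers P b g (girl_of mu b).
  apply: (head_best cP (head_of_propose0 s g b)).
    by rewrite /= eqxx mem_insert (cinv_mem inv) orbT.
  by apply: contraNneq gb => <-; apply: (cinv_mem inv).
apply/forallP => b'; apply/implyP => ib'.
have [->//|bb'] := eqVneq b' b.
apply/ltnW/(props_prefers cP bgp); rewrite /= eqxx mem_rcons inE (negPf bb') /=.
by apply/negP => b'g; apply: (negP (cinv_reject inv cs fP b'g)).
Qed.

Lemma accept_succ P : consistent (propose s g b 0) P -> f P -> succ P mu g = mu b.
Proof. by move=> cP fP; apply: succE; apply: accept_first_improving. Qed.

Lemma iter_proposer P : consistent s P -> f P ->
  iter (size path) (succ P mu) g1 = g.
Proof.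
move=> cs fP; have := congr1 (last g1) (cinv_track inv cs fP).
by rewrite trajectS /= last_traject.
Qed.

Lemma accept_track P : consistent (propose s g b 0) P -> f P ->
  traject (succ P mu) g1 (size path).+2 = rcons (g1 :: map mu path) (mu b).
Proof.
move=> cP fP; have cs := consistent_s (leq0n _) cP.
by rewrite trajectSr (cinv_track inv cs fP) iterS iter_proposer // accept_succ.
Qed.

(** The dismissed girl [mu b] approached [b] last, so she ranks everyone she has approached at least
    as high as him; this re-establishes [cinv_reject] for the new proposer. *)
Lemma chain_accept : b \notin b1 :: path ->
  chain_inv f (propose s g b 0) (rcons path b).
Proof.
move=> bp; have w := cinv_wf inv.
have mbg : mu b != g by apply: mu_neq_proposer.
have w' : wf (propose s g b 0) by apply: wf_propose.
have memS c : mu c \in recv (propose s g b 0) c.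
  by rewrite /=; case: eqP => [->|_]; rewrite ?mem_insert (cinv_mem inv) ?orbT.
have propb : proposer (rcons path b) = mu b by rewrite /proposer map_rcons last_rcons.
split=> //.
- by rewrite -rcons_cons rcons_uniq bp (cinv_uniq inv).
- move=> c; rewrite mem_rcons inE negb_or => /andP[cb cp].
  by rewrite head_of_propose_neq // (cinv_head inv cp).
- move=> c; rewrite -rcons_cons mem_rcons in_cons negb_or => /andP[cb cp].
  by rewrite /= (negPf (mu_neq_proposer cp)) (cinv_last inv cp).
- by move=> P cP fP; rewrite size_rcons accept_track // map_rcons.
move=> P c cP fP; rewrite propb /= (negPf mbg) => cm.
have cs := consistent_s (leq0n _) cP; rewrite /improving negb_and; apply/orP; left.
have [->|cneq] := eqVneq c (boy_of mu (mu b)).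
  by rewrite /girl_prefers ltnn.
have := cinv_last inv bp => lb.
have -> : boy_of mu (mu b) = b by rewrite /boy_of permK.
rewrite /boy_of permK in cneq.
have lb' : last c (props s (mu b)) = b by move: lb cm; case: (props s _).
have := last_prefers cs (wf_props w _) lb' cm cneq.
by rewrite /girl_prefers -leqNgt => /ltnW.
Qed.

Lemma chain_reject_gen i : (0 < i <= size (recv s b))%N ->
  (forall P, consistent (propose s g b i) P -> f P -> ~~ improving P mu g b) ->
  chain_inv f (propose s g b i) path.
Proof.
move=> i0 rej; have /andP[ipos ib] := i0; have w := cinv_wf inv.
split=> //.
- exact: wf_propose.
- exact: cinv_uniq inv.
- move=> c; have [->|cb] := eqVneq c b => cp.
    by rewrite head_of_propose // (cinv_head inv).
  by rewrite head_of_propose_neq // (cinv_head inv).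
- by move=> c /=; case: eqP => [->|_]; rewrite ?mem_insert (cinv_mem inv) ?orbT.
- move=> c cp.
  by rewrite /= (negPf (mu_neq_proposer cp)) (cinv_last inv cp).
- move=> P cP fP; exact: cinv_track (consistent_s ib cP) fP.
move=> P c cP fP; rewrite /= eqxx mem_rcons inE => /orP[/eqP ->|]; first exact: rej cP fP.
exact: cinv_reject (consistent_s ib cP) fP.
Qed.

(** Outside the path the head is still [mu b], so a boy who rejects [g] ranks her below his
    partner. *)
Lemma chain_reject i : (0 < i <= size (recv s b))%N -> b \notin path ->
  chain_inv f (propose s g b i) path.
Proof.
move=> i0 bp; apply: chain_reject_gen => // P cP fP.
rewrite /improving negb_and; apply/orP; right.
have w := cinv_wf inv; have /andP[ipos ib] := i0.
have hd : head_of (propose s g b i) b = Some (mu b).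
  by rewrite head_of_propose // (cinv_head inv).
have gb : g \notin recv s b by rewrite (wf_mem w).
have := head_best (g' := g) cP hd; rewrite /= eqxx mem_insert eqxx => /(_ isT).
have -> : g != mu b by apply: contraNneq gb => ->; apply: (cinv_mem inv).
by move=> /(_ isT); rewrite /boy_prefers -leqNgt => /ltnW.
Qed.

Lemma distinct_path P k : consistent s P -> f P -> (size path < k)%N ->
  uniq (traject (succ P mu) (succ P mu g1) k) -> succ P mu g \notin map mu path.
Proof.
move=> cs fP kp u.
have : uniq (traject (succ P mu) (succ P mu g1) (size path).+1).
  by rewrite -(@take_traject _ _ k _ _ kp) take_uniq.
have -> : traject (succ P mu) (succ P mu g1) (size path).+1 =
    rcons (map mu path) (succ P mu g).
  rewrite -[LHS]/(behead (traject (succ P mu) g1 (size path).+2)) trajectSr.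
  by rewrite (cinv_track inv cs fP) iterS iter_proposer.
by rewrite rcons_uniq => /andP[].
Qed.

(** If a rejecting boy of the path were improving, he would be the first improving one, and [succ]
    would return to a girl already visited. *)
Lemma chain_reject_distinct i k : (0 < i <= size (recv s b))%N -> (size path < k)%N ->
  (forall P, consistent s P -> f P -> uniq (traject (succ P mu) (succ P mu g1) k)) ->
  chain_inv f (propose s g b i) path.
Proof.
move=> i0 kp dist; have [bp|bp] := boolP (b \in path); last exact: chain_reject.
have /andP[_ ib] := i0.
apply: chain_reject_gen => // P cP fP; apply/negP => imp.
have cs := consistent_s ib cP.
have first : first_improving P mu g b.
  rewrite /first_improving imp; apply/forallP => c; apply/implyP => ic.
  have [->//|cb] := eqVneq c b.
  apply/ltnW/(props_prefers cP (b := b)); first by rewrite /= eqxx mem_rcons inE eqxx.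
  rewrite /= eqxx mem_rcons inE (negPf cb) /=.
  by apply/negP => cg; apply: (negP (cinv_reject inv cs fP cg)).
have := distinct_path cs fP kp (dist _ cs fP).
by rewrite (succE first) mem_map ?bp //; apply: perm_inj.
Qed.

End Step.
End ChainPhase.

(** * Potentials controlling atypical histories *)

Section Potentials.
Variables (R : realFieldType) (n : nat).
Implicit Types (g b h : 'I_n) (s : state n) (S : {set 'I_n}).
Variables (K m T : nat).

(* While no boy has more than [K] proposals, a proposal is accepted with
   probability at least [2 * slack].  Doubling the weight of a single girl makes
   this chance of acceptance pay for the factor [base = 1 + slack] that each of
   her proposals costs; [growth] absorbs the other changes. *)
Definition slack : R := (K.+1%:R)^-1 / 2.
Definition growth : R := 1 + 2 / n%:R.
Definition base : R := 1 + slack.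
Definition nprops s : nat := (\sum_h size (props s h))%N.
Definition load s : R := \sum_b 2 ^+ size (recv s b).
Definition girl_load s S : R := \sum_h base ^+ size (props s h) * (h \in S).+1%:R.
(** The denominators make a single boy above [K] or girl above [m] push the potential to 1; the
    power of [growth] is the reserve for the steps left until [T]. The set [S] consists of the girls
    entitled to propose. *)
Definition potential s S : R :=
  (load s / 2 ^+ K + girl_load s S / base ^+ m) * growth ^+ (T - nprops s).
Definition good s : bool :=
  [forall b, (size (recv s b) <= K)%N] && [forall h, (size (props s h) <= m)%N].
Definition displace S g (o : option 'I_n) : {set 'I_n} :=
  if o is Some h then h |: (S :\ g) else S :\ g.

Lemma slack_gt0 : 0 < slack.
Proof. by rewrite divr_gt0 ?invr_gt0 ?ltr0n. Qed.

Lemma slack_lt1 : slack < 1.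
Proof.
rewrite /slack ltr_pdivrMr ?ltr0n // mul1r.
by rewrite (@le_lt_trans _ _ 1) ?ltr1n // invf_le1 ?ltr0n // ler1n.
Qed.

Lemma base_gt1 : 1 < base.
Proof. by rewrite /base ltrDl slack_gt0. Qed.

Lemma growth_ge1 : 1 <= growth.
Proof. by rewrite /growth lerDl divr_ge0. Qed.

Lemma base_exp_gt0 k : 0 < base ^+ k.
Proof. by rewrite exprn_gt0 // (lt_trans ltr01 base_gt1). Qed.

Lemma growth_exp_ge1 k : 1 <= growth ^+ k.
Proof. by rewrite exprn_ege1 // growth_ge1. Qed.

Lemma base_exp_ge0 k : 0 <= base ^+ k.
Proof. exact/ltW/base_exp_gt0. Qed.

Lemma growth_exp_ge0 k : 0 <= growth ^+ k.
Proof. exact: le_trans ler01 (growth_exp_ge1 _). Qed.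

Lemma load_ge0 s : 0 <= load s.
Proof. by apply: sumr_ge0 => b _; rewrite exprn_ge0. Qed.

Lemma girl_load_ge0 s S : 0 <= girl_load s S.
Proof. by apply: sumr_ge0 => h _; rewrite mulr_ge0 // base_exp_ge0. Qed.

Lemma potential_ge0 s S : 0 <= potential s S.
Proof.
rewrite /potential mulr_ge0 ?growth_exp_ge0 // addr_ge0 // mulr_ge0 ?invr_ge0 //;
  by rewrite ?load_ge0 ?girl_load_ge0 ?base_exp_ge0 ?exprn_ge0.
Qed.

Lemma potential_mono s S S' : S \subset S' -> potential s S <= potential s S'.
Proof.
move=> SS'; rewrite /potential ler_wpM2r ?growth_exp_ge0 //.
rewrite lerD2l ler_wpM2r ?invr_ge0 ?base_exp_ge0 //.
apply: ler_sum => h _; rewrite ler_wpM2l ?base_exp_ge0 // ler_nat ltnS.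
by have := fintype.subsetP SS' h; case: (h \in S) => // ->.
Qed.

Lemma potential_bad s S : ~~ good s -> 1 <= potential s S.
Proof.
have big1 x c : 1 <= x -> 0 <= c -> (1 : R) <= (x + c) * growth ^+ (T - nprops s).
  move=> x1 c0; rewrite -[1]mulr1 ler_pM ?growth_exp_ge1 //.
  by rewrite (le_trans x1) // lerDl.
rewrite /good negb_and !negb_forall => /orP[/existsP[b]|/existsP[h]]; rewrite -ltnNge => lt.
  apply: big1; last by rewrite divr_ge0 ?girl_load_ge0 // ltW ?base_exp_gt0.
  rewrite ler_pdivlMr ?exprn_gt0 // mul1r /load (bigD1 b) //= ler_wpDr //.
    by apply: sumr_ge0 => ? _; rewrite exprn_ge0.
  by rewrite ler_eXn2l ?ltr1n // ltnW.
rewrite /potential addrC; apply: big1; last by rewrite divr_ge0 ?load_ge0 // exprn_ge0.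
rewrite ler_pdivlMr ?base_exp_gt0 // mul1r /girl_load (bigD1 h) //= ler_wpDr //.
  by apply: sumr_ge0 => ? _; rewrite mulr_ge0 // base_exp_ge0.
rewrite -[leLHS]mulr1 ler_pM ?base_exp_ge0 ?ler1n //.
by rewrite ler_eXn2l ?base_gt1 // ltnW.
Qed.

Lemma nprops_propose s g b i : nprops (propose s g b i) = (nprops s).+1.
Proof.
rewrite /nprops (bigD1 g) //= eqxx size_rcons addSn [in RHS](bigD1 g) //=.
by congr S; congr addn; apply: eq_bigr => h /negPf ->.
Qed.

Lemma load_propose s g b i :
  load (propose s g b i) = load s + 2 ^+ size (recv s b).
Proof.
rewrite /load (bigD1 b) //= eqxx size_insert exprS mulrDl !mul1r.
rewrite [in RHS](bigD1 b) //= -addrA addrC; congr (_ + _).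
by congr (_ + _); apply: eq_bigr => c /negPf ->.
Qed.

Lemma girl_load_split s S g : girl_load s S =
  base ^+ size (props s g) * (g \in S).+1%:R +
  \sum_(h | h != g) base ^+ size (props s h) * (h \in S).+1%:R.
Proof. by rewrite /girl_load (bigD1 g). Qed.

Lemma girl_load_propose_split s S g b i : girl_load (propose s g b i) S =
  base ^+ (size (props s g)).+1 * (g \in S).+1%:R +
  \sum_(h | h != g) base ^+ size (props s h) * (h \in S).+1%:R.
Proof.
rewrite (girl_load_split _ _ g) /= eqxx size_rcons; congr (_ + _).
by apply: eq_bigr => h /negPf ->.
Qed.

Lemma girl_load_reject s S g b i : g \in S ->
  girl_load (propose s g b i) S =
  girl_load s S + base ^+ size (props s g) * (2 * slack).
Proof.
move=> gS; rewrite girl_load_propose_split (girl_load_split _ _ g) gS exprS /base /=.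
by ring.
Qed.

Definition displaced_load s (o : option 'I_n) : R :=
  if o is Some h then base ^+ size (props s h) else 0.

(** The weight of [g] drops from double to single while her exponent grows, and the girl she
    displaces starts to count double. *)
Lemma girl_load_accept s S g b i o : g \in S -> o != Some g ->
  girl_load (propose s g b i) (displace S g o) <=
  girl_load s S + base ^+ size (props s g) * (slack - 1) + displaced_load s o.
Proof.
move=> gS og.
have gD : g \in displace S g o = false.
  rewrite /displace; case: o og => [h|] og; rewrite !inE eqxx //= orbF.
  by apply: contraNF og => /eqP ->.
rewrite girl_load_propose_split (girl_load_split s S g) gD gS.
set X := \sum_(h | _) _; set Y := \sum_(h | _) _.
have XY : X <= Y + displaced_load s o.
  rewrite /X /Y /displaced_load /displace; case: o {gD X Y} og => [h|] og; last first.
    rewrite addr0; apply: ler_sum => h hg.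
    by rewrite !inE hg.
  have hg : h != g by apply: contraNneq og => ->.
  rewrite (bigD1 h) //= [X in _ <= X + _](bigD1 h) //= addrAC lerD //.
    rewrite !inE eqxx /= -[X in _ <= _ + X]mulr1 -mulrDr ler_wpM2l ?base_exp_ge0 //.
    by rewrite natr1 ler_nat.
  apply: ler_sum => h' /andP[h'g h'h]; by rewrite !inE h'g (negPf h'h).
rewrite exprS /base /=; move: XY; set B := (1 + slack) ^+ _; lra.
Qed.

Lemma sum_displaced s S (D : {pred 'I_n}) (disp : 'I_n -> option 'I_n) :
  (forall b b' h, disp b = Some h -> disp b' = Some h -> b = b') ->
  \sum_(b in D) displaced_load s (disp b) <= girl_load s S.
Proof.
move=> inj.
have dE b : displaced_load s (disp b) =
    \sum_h if disp b == Some h then base ^+ size (props s h) else 0.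
  rewrite -big_mkcond /=; case E : (disp b) => [h|] /=; last by rewrite big_pred0.
  by rewrite (big_pred1 h) // => h' ; rewrite eq_sym.
rewrite (eq_bigr _ (fun b _ => dE b)) exchange_big; apply: ler_sum => h _ /=.
rewrite -big_mkcondr /=.
have [|none] := pickP (fun b => (b \in D) && (disp b == Some h)); last first.
  by rewrite big_pred0 // mulr_ge0 ?base_exp_ge0.
move=> b /andP[bD /eqP db]; rewrite (big_pred1 b) => [|c].
  by rewrite -[leLHS]mulr1 ler_wpM2l ?ler1n // base_exp_ge0.
apply/andP/eqP => [[_ /eqP dc]|->]; first exact: inj dc db.
by rewrite bD db.
Qed.

Lemma accept_prob_ge s b : good s -> (K.+1%:R)^-1 <= accept_prob R s b.
Proof.
move=> /andP[/forallP/(_ b) k _].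
by rewrite /accept_prob lef_pV2 ?posrE ?ltr0n // ler_nat ltnS.
Qed.

(** With acceptance probability [w], the expected change of the proposer's own term is proportional
    to 2 slack - w - w slack, hence not positive. What remains, the new load of the boy and the
    displaced girl, averages to at most the potential divided by n - a, which is at most 2/n of it
    since [m.*2 <= n]. *)
Lemma potential_step s S g (disp : 'I_n -> option 'I_n) :
  (0 < n)%N -> (m.*2 <= n)%N -> good s -> g \in S -> (nprops s < T)%N ->
  uniq (props s g) ->
  (forall b, disp b != Some g) ->
  (forall b b' h, disp b = Some h -> disp b' = Some h -> b = b') ->
  average s g (fun b => potential (propose s g b 0) (displace S g (disp b)))
              (fun b => potential (propose s g b 0) S) <= potential s S.
Proof.
move=> n0 mn gs gS tT ug dg inj; rewrite /potential.
have -> : (T - nprops s)%N = (T - (nprops s).+1).+1 by rewrite -subSn // subSS.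
have [_ /forallP/(_ g) am] := andP gs.
set a := size (props s g) in am *; have an : (a < n)%N by lia.
have an2 : (n <= (n - a).*2)%N by rewrite -addnn; lia.
set gr := growth ^+ (T - (nprops s).+1).
have gr1 : 0 <= gr by apply: growth_exp_ge0.
pose e b := 2 ^+ size (recv s b) / 2 ^+ K + displaced_load s (disp b) / base ^+ m.
pose c0 := load s / 2 ^+ K + girl_load s S / base ^+ m.
have bm := base_exp_gt0 m.
apply: (@le_trans _ _ ((n - a)%:R^-1 * \sum_(b | b \notin props s g) (c0 + e b) * gr)).
  rewrite /average ler_wpM2l ?invr_ge0 //; apply: ler_sum => b bg.
  rewrite !nprops_propose -/gr !mulrA -mulrDl ler_wpM2r //.
  rewrite load_propose (@girl_load_reject s S g b 0 gS).
  have := girl_load_accept s b 0 gS (dg b).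
  have := accept_prob_ge b gs; have := accept_prob_le1 R s b.
  move: (accept_prob R s b) => w w1 wK; rewrite /c0 /e.
  set G' := girl_load _ _; set G := girl_load s S; set ba := base ^+ size _.
  set D := displaced_load _ _; set L := load s; set k := 2 ^+ size _ => hG'.
  have w0 : 0 <= w by rewrite (le_trans _ wK) // invr_ge0.
  have D0 : 0 <= D.
    by rewrite /D /displaced_load; case: (disp b) => // h; rewrite ltW ?base_exp_gt0.
  have ba0 : 0 <= ba by rewrite base_exp_ge0.
  have key : w * G' + (1 - w) * (G + ba * (2 * slack)) <= G + D.
    apply: (@le_trans _ _ (w * (G + ba * (slack - 1) + D) + (1 - w) * (G + ba * (2 * slack)))).
      by rewrite lerD2r ler_wpM2l.
    have : 0 <= ba * (w - 2 * slack).
      rewrite mulr_ge0 // subr_ge0; apply: le_trans wK.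
      by rewrite /slack mulrCA mulfV ?mulr1 // pnatr_eq0.
    have : 0 <= ba * w * slack by apply: mulr_ge0; [exact: mulr_ge0 | exact/ltW/slack_gt0].
    have : 0 <= (1 - w) * D by rewrite mulr_ge0 // subr_ge0.
    by lra.
  have : (w * G' + (1 - w) * (G + ba * (2 * slack))) / base ^+ m <= (G + D) / base ^+ m.
    by rewrite ler_wpM2r // invr_ge0 ltW.
  set bmi := (base ^+ m)^-1; set Ki := (2 ^+ K)^-1; move=> h; clearbody G'. 
  apply: (@le_trans _ _ ((L + k) * Ki + (w * G' + (1 - w) * (G + ba * (2 * slack))) * bmi)).
    by rewrite le_eqVlt; apply/orP; left; apply/eqP; ring.
  apply: (le_trans (lerD (lexx _) h)).
  by rewrite le_eqVlt; apply/orP; left; apply/eqP; ring.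
rewrite -mulr_suml mulrA exprS -/gr [leRHS]mulrA ler_wpM2r // big_split /=.
rewrite sumr_const card_notin // -/a -[c0 *+ _]mulr_natl mulrDr mulKf; last first.
  by rewrite pnatr_eq0 subn_eq0 -ltnNge.
rewrite -/c0 /growth mulrDr mulr1 lerD2l mulrC.
have e0 : \sum_(b | b \notin props s g) e b <= c0.
  rewrite /e big_split /= -!mulr_suml lerD // ler_wpM2r ?invr_ge0 ?base_exp_ge0 ?exprn_ge0 //.
    rewrite /load [leRHS](bigID (fun b => b \notin props s g)) /= lerDl.
    by apply: sumr_ge0 => b _; rewrite exprn_ge0.
  exact: sum_displaced.
have c00 : 0 <= c0.
  by rewrite /c0 addr_ge0 // mulr_ge0 ?load_ge0 ?girl_load_ge0 ?invr_ge0 ?base_exp_ge0 ?exprn_ge0.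
apply: (@le_trans _ _ (c0 * (n - a)%:R^-1)).
  by rewrite ler_wpM2r // invr_ge0.
rewrite ler_wpM2l // -[2 / _]invf_div lef_pV2 ?posrE ?ltr0n ?subn_gt0 //; last first.
  by rewrite divr_gt0 ?ltr0n.
by rewrite ler_pdivrMr ?ltr0n // -natrM ler_nat muln2.
Qed.

Lemma potential_propose s S g b i : potential (propose s g b i) S = potential (propose s g b 0) S.
Proof. by rewrite /potential !nprops_propose !load_propose /girl_load. Qed.

Definition empties s : nat := #|[set b | recv s b == [::]]|.

Lemma empties_propose s g b i : empties (propose s g b i) = (empties s - (recv s b == [::]))%N.
Proof.
rewrite /empties [in RHS](cardsD1 b) inE addKn; apply: eq_card => c.
rewrite !inE /=; have [->|//] := eqVneq c b.
by rewrite -size_eq0 size_insert.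
Qed.

Variable T1 : nat.
(** Coupon collector: each boy without proposals receives the next one with probability at least
    1/n, and the algorithm ends when none is left. *)
Definition empties_pot s : R := (empties s)%:R * (1 - n%:R^-1) ^+ (T1 - nprops s).

Lemma empties_pot_ge0 s : (0 < n)%N -> 0 <= empties_pot s.
Proof.
move=> n0; rewrite mulr_ge0 // exprn_ge0 // subr_ge0 invf_le1 ?ltr0n // ler1n //.
Qed.

Lemma empties_pot_step s g : wf s -> (size (props s g) < n)%N -> (nprops s < T1)%N ->
  average s g (fun b => empties_pot (propose s g b 0)) (fun b => empties_pot (propose s g b 0))
  <= empties_pot s.
Proof.
move=> w gn tT; have n0 : (0 < n)%N by apply: leq_ltn_trans gn.
rewrite /average /empties_pot.
have -> : (T1 - nprops s)%N = (T1 - (nprops s).+1).+1 by rewrite -subSn // subSS.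
set q := 1 - n%:R^-1.
have q0 : 0 <= q by rewrite subr_ge0 invf_le1 ?ltr0n // ler1n.
have sub b : (empties s - (recv s b == [::]))%:R = (empties s)%:R - (recv s b == [::])%:R :> R.
  rewrite natrB //; case: eqP => // rb; rewrite lt0n cards_eq0.
  by apply/finset.set0Pn; exists b; rewrite inE rb.
rewrite (eq_bigr (fun b => ((empties s)%:R - (recv s b == [::])%:R) *
    q ^+ (T1 - (nprops s).+1))); last first.
  move=> b _; rewrite !nprops_propose !empties_propose sub.
  by rewrite -mulrDl addrC subrK mul1r.
rewrite -mulr_suml mulrA exprS [leRHS]mulrA ler_wpM2r ?exprn_ge0 //.
rewrite big_split /= sumr_const card_notin ?wf_props // -[(empties s)%:R *+ _]mulr_natl mulrDr mulKf; last first.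
  by rewrite pnatr_eq0 subn_eq0 -ltnNge.
rewrite /q mulrBr mulr1 lerD2l sumrN mulrN lerN2.
have -> : \sum_(b | b \notin props s g) (recv s b == [::])%:R = (empties s)%:R :> R.
  rewrite -natr_sum /empties -sum1_card big_mkcond [in RHS]big_mkcond /=.
  congr _%:R; apply: eq_bigr => b _; rewrite inE.
  case: (boolP (b \in props s g)) => [bg|_]; last by case: eqP.
  rewrite -wf_mem // in bg; by move: bg; case: (recv s b).
rewrite mulrC ler_wpM2r // lef_pV2 ?posrE ?ltr0n ?subn_gt0 // ler_nat leq_subr //.
Qed.

Variables (K1 M t0 : nat).
(* Large when [t - t0] proposals have produced only [j] acceptances. *)
Definition slow_pot (j t : nat) : R := 2 ^+ (K1 - j) * (1 - slack) ^+ (M - (t - t0)).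

Lemma slow_pot_ge0 j t : 0 <= slow_pot j t.
Proof. by rewrite mulr_ge0 ?exprn_ge0 // subr_ge0 ltW // slack_lt1. Qed.

Lemma slow_pot_ge1 j t : (M <= t - t0)%N -> 1 <= slow_pot j t.
Proof.
rewrite -subn_eq0 => /eqP e; rewrite /slow_pot e expr0 mulr1.
by rewrite exprn_ege1 // ler1n.
Qed.

(** An acceptance of probability [w] halves the first factor, so the mean factor is 1 - w/2, at most
    [1 - slack]. *)
Lemma slow_pot_step s g j : good s -> uniq (props s g) -> (size (props s g) < n)%N ->
  (j < K1)%N -> (t0 <= nprops s)%N -> (nprops s - t0 < M)%N ->
  average s g (fun=> slow_pot j.+1 (nprops s).+1) (fun=> slow_pot j (nprops s).+1)
  <= slow_pot j (nprops s).
Proof.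
move=> gs ug gn jK t0s sM; rewrite -[leRHS](average_cst (s := s) (g := g) _ ug gn).
rewrite /average ler_wpM2l ?invr_ge0 //; apply: ler_sum => b _.
have := accept_prob_ge b gs; have := accept_prob_le1 R s b.
move: (accept_prob R s b) => w w1 wK.
rewrite /slow_pot subSn //.
have -> : (M - (nprops s - t0))%N = (M - (nprops s - t0).+1).+1 by rewrite -subSn // subSS.
have -> : (K1 - j)%N = (K1 - j.+1).+1 by rewrite -subSn // subSS.
rewrite !exprS; set x := 2 ^+ _; set y := _ ^+ _.
have x0 : 0 <= x * y.
  by rewrite mulr_ge0 ?exprn_ge0 // subr_ge0 ltW // slack_lt1.
have : 2 * slack <= w by apply: le_trans wK; rewrite /slack mulrCA mulfV ?mulr1 // pnatr_eq0.
move: slack => sl sw; have : 0 <= (x * y) * (w - 2 * sl) by rewrite mulr_ge0 // subr_ge0.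
lra.
Qed.

End Potentials.

(** * Supermartingale estimates *)

Section Bounds.
Variables (R : realFieldType) (n : nat).
Implicit Types (g b h : 'I_n) (s : state n) (P : profile n) (mu : matching n)
  (path : seq 'I_n).
Variables (K m T : nat).
Hypotheses (n_gt0 : (0 < n)%N) (mn : (m.*2 <= n)%N).

Notation potential := (potential R K m T).
Notation accept_prob := (accept_prob R).

Definition singles s : {set 'I_n} := [set g | single s g].

Lemma good_size s g : good K m s -> (size (props s g) <= m)%N /\ (size (props s g) < n)%N.
Proof. by move=> /andP[_ /forallP/(_ g) am]; split=> //; lia. Qed.

Lemma singles_accept s g b : single s g ->
  singles (propose s g b 0) \subset displace (singles s) g (head_of s b).
Proof.
move=> /forallP sg; apply/fintype.subsetP => h; rewrite inE => /forallP hs.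
have hg : h != g by apply: contraTneq (hs b) => ->; rewrite head_of_propose0 eqxx.
have [hb|hb] := eqVneq (head_of s b) (Some h); first by rewrite hb !inE eqxx.
have : h \in singles s :\ g.
  rewrite !inE hg; apply/forallP => c; have [->//|cb] := eqVneq c b.
  by have := hs c; rewrite head_of_propose_neq.
by rewrite /displace; case: (head_of s b) => // h' ?; rewrite inE orbC; apply/orP; left.
Qed.

Lemma singles_reject s g b i : (0 < i <= size (recv s b))%N ->
  singles (propose s g b i) \subset singles s.
Proof.
move=> i0; apply/fintype.subsetP => h; rewrite !inE => /forallP hs; apply/forallP => c.
have := hs c; have [->|cb] := eqVneq c b; first by rewrite head_of_propose.
by rewrite head_of_propose_neq.
Qed.

Section ProposalBound.
Variables (T1 : nat) (X : profile n -> R) (c1 c2 : R).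
Hypotheses (T1T : (T1 <= T)%N) (c2_ge0 : 0 <= c2) (c12 : 0 <= c1 + c2).
Hypothesis X_le : forall P, X P <= c1 + c2.
Hypothesis X_final : forall s mu, proposal_inv s -> (forall b, head_of s b = Some (mu b)) ->
  (nprops s <= T1)%N -> cexp s X <= c1 + c2 * potential s finset.set0.

(** Induction on the remaining proposals. A bad state, or an unapproached boy at time [T1], brings
    the potentials to 1, and the crude bound [c1 + c2] suffices; in every other unfinished state a
    single girl proposes and the potentials do not increase on average. *)
Lemma proposal_bound s : proposal_inv s -> (nprops s <= T1)%N ->
  cexp s X <= c1 + c2 * (potential s (singles s) + empties_pot R T1 s).
Proof.
have [d] := ubnP (T1 - nprops s)%N; elim: d s => // d IHd s dT inv sT.
have w := pinv_wf inv; have u0 := empties_pot_ge0 R T1 s n_gt0.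
have p0 := potential_ge0 R K m T s (singles s).
have trivial : 1 <= potential s (singles s) + empties_pot R T1 s ->
    cexp s X <= c1 + c2 * (potential s (singles s) + empties_pot R T1 s).
  move=> ge1; apply: (@le_trans _ _ (c1 + c2)); first exact: cexp_le.
  by rewrite lerD2l ler_peMr.
have [full|] := boolP [forall b, head_of s b != None].
  have [mu hmu] := proposal_complete inv (forallP full).
  apply: (le_trans (X_final inv hmu sT)); rewrite lerD2l ler_wpM2l //.
  rewrite ler_wpDr // potential_mono //; exact: finset.sub0set.
rewrite negb_forall => /existsP[b0]; rewrite negbK => /eqP hb0.
have rb0 : recv s b0 = [::] by move: hb0; rewrite /head_of; case: (recv s b0).
have [sT1|sT1] := ltnP (nprops s) T1; last first.
  apply: trivial; rewrite ler_wpDl // /empties_pot.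
  have -> : (T1 - nprops s = 0)%N by apply/eqP; rewrite subn_eq0.
  rewrite mulr1 ler1n lt0n cards_eq0; apply/finset.set0Pn; exists b0.
  by rewrite inE rb0.
have [gs|bad] := boolP (good K m s); last first.
  by apply: trivial; rewrite ler_wpDr // potential_bad.
have [g sg] : exists g, single s g.
  apply/existsP; apply: contraT; rewrite negb_exists => /forallP nos.
  have pick g : {b | head_of s b = Some g}.
    have /existsP ex : [exists b, head_of s b == Some g].
      by have := nos g; rewrite /single negb_forall; under eq_existsb do rewrite negbK.
    by exists (xchoose ex); apply/eqP; exact: xchooseP ex.
  have inj : injective (fun g => sval (pick g)).
    move=> g g' /= e; have := svalP (pick g); rewrite /= e (svalP (pick g')).
    by case.
  have := svalP (pick (invF inj b0)); have := f_invF inj b0 => /= ->.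
  by rewrite hb0.
have [_ gn] := good_size g gs.
have step b i : b \notin props s g -> (i <= size (recv s b))%N ->
    cexp (propose s g b i) X <= c1 + c2 * (potential (propose s g b i) (singles (propose s g b i))
      + empties_pot R T1 (propose s g b i)).
  move=> bg ib; apply: IHd; rewrite ?nprops_propose //; first by lia.
  exact: proposal_inv_propose.
pose A b := c1 + c2 * (potential (propose s g b 0) (displace (singles s) g (head_of s b))
   + empties_pot R T1 (propose s g b 0)).
pose B b := c1 + c2 * (potential (propose s g b 0) (singles s)
   + empties_pot R T1 (propose s g b 0)).
apply: (@le_trans _ _ (average s g A B)).
  apply: cexp_step_le => //; [exact: wf_props|by move=> b; rewrite wf_mem|exact: wf_recv| |].
    move=> b bg; apply: (le_trans (step b 0%N bg (leq0n _))).
    rewrite lerD2l ler_wpM2l // lerD2r potential_mono //; exact: singles_accept.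
  move=> b i bg i0; have /andP[_ ib] := i0; apply: (le_trans (step b i bg ib)).
  rewrite lerD2l ler_wpM2l // /empties_pot !nprops_propose !empties_propose lerD2r.
  rewrite -(potential_propose _ _ _ _ _ _ _ _ i) potential_mono //; exact: singles_reject.
rewrite average_add average_cst ?wf_props // lerD2l averageZ ler_wpM2l // average_add.
rewrite lerD //; last exact: empties_pot_step.
apply: potential_step => //; rewrite ?wf_props ?inE //; first exact: leq_trans T1T.
  by move=> b; have /forallP := sg; apply.
by move=> b b' h; apply: head_of_inj.
Qed.

End ProposalBound.

Lemma average_le_cst s g (A B : 'I_n -> R) c : uniq (props s g) -> (size (props s g) < n)%N ->
  \sum_(b | b \notin props s g)
     (accept_prob s b * (A b - c) + (1 - accept_prob s b) * (B b - c)) <= 0 ->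
  average s g A B <= c.
Proof.
move=> ug gn h; rewrite -[leRHS](average_cst (s := s) (g := g) _ ug gn).
rewrite /average ler_wpM2l ?invr_ge0 // -subr_le0 -sumrB; apply: le_trans h.
rewrite le_eqVlt; apply/orP; left; apply/eqP; apply: eq_bigr => b _; ring.
Qed.

Definition total_accept s : R := \sum_b accept_prob s b.

Lemma accept_prob_propose s g b i c : accept_prob (propose s g b i) c <= accept_prob s c.
Proof.
rewrite lef_pV2 ?posrE ?ltr0n // ler_nat ltnS /=.
by case: eqP => // ->; rewrite size_insert.
Qed.

Lemma total_accept_propose s g b i :
  total_accept s - 1 <= total_accept (propose s g b i) <= total_accept s.
Proof.
apply/andP; split; last by apply: ler_sum => c _; apply: accept_prob_propose.
rewrite /total_accept (bigD1 b) //= [leRHS](bigD1 b) //=.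
rewrite [X in _ <= _ + X](eq_bigr (accept_prob s)) => [|c /negPf cb]; last by rewrite -[LHS]/((size (if c == b then _ else recv s c)).+1%:R^-1) cb.
have := accept_prob_le1 R s b; have := accept_prob_gt0 R (propose s g b i) b.
by lra.
Qed.

Lemma sum_mem_le (p : seq 'I_n) (D : pred 'I_n) : \sum_(b | D b) (b \in p)%:R <= (size p)%:R :> R.
Proof.
rewrite -natr_sum ler_nat (leq_trans _ (card_size p)) // -sum1_card.
rewrite [leqRHS]big_mkcond [leqLHS]big_mkcond /=; apply: leq_sum => b _.
by case: (D b); case: (b \in p).
Qed.

Lemma sum_notin_ge (p q : seq 'I_n) : uniq p ->
  (size p)%:R - (size q)%:R <= \sum_(b | b \notin q) (b \in p)%:R :> R.
Proof.
move=> up; rewrite lerBlDr -(card_uniqP up) -sum1_card natr_sum big_mkcond /=.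
rewrite (bigID (fun b => b \notin q)) /= lerD //.
  by apply: ler_sum => b _; case: (b \in p).
apply: le_trans (sum_mem_le q xpredT); rewrite [leLHS]big_mkcond /=.
by apply: ler_sum => b _; rewrite negbK; case: (b \in q); case: (b \in p).
Qed.

Lemma sum_accept_notin s (p : seq 'I_n) :
  total_accept s - (size p)%:R <= \sum_(b | b \notin p) accept_prob s b.
Proof.
rewrite lerBlDr /total_accept (bigID (fun b => b \notin p)) /= lerD2l.
apply: le_trans (sum_mem_le p xpredT); rewrite [leLHS]big_mkcond /=.
by apply: ler_sum => b _; rewrite negbK; case: (b \in p); rewrite ?accept_prob_le1.
Qed.

End Bounds.

(** * Probability that a chain closes, or stays open for long *)

Section ChainBounds.
Variables (R : realFieldType) (n : nat).
Implicit Types (g b h : 'I_n) (s : state n) (P : profile n) (path : seq 'I_n).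
Variables (K m T K1 M t0 : nat) (mu : matching n) (g1 : 'I_n).
Hypotheses (n_gt0 : (0 < n)%N) (mn : (m.*2 <= n)%N) (t0M : (t0 + M <= T)%N).

Notation potential := (potential R K m T).
Notation accept_prob := (accept_prob R).
Notation b1 := (boy_of mu g1).
Notation proposer := (proposer mu g1).

Definition chain_pot s path : R :=
  potential s [set proposer path] + slow_pot R K K1 M t0 (size path) (nprops s).

Lemma chain_pot_ge0 s path : 0 <= chain_pot s path.
Proof. by rewrite addr_ge0 ?potential_ge0 ?slow_pot_ge0. Qed.

Lemma chain_pot_ge1 s path : ~~ good K m s || (M <= nprops s - t0)%N -> 1 <= chain_pot s path.
Proof.
case/orP => [bad|late].
  by rewrite ler_wpDr ?slow_pot_ge0 // potential_bad.
by rewrite ler_wpDl ?potential_ge0 // slow_pot_ge1.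
Qed.

Section Step.
Variables (f : pred (profile n)) (s : state n) (path : seq 'I_n).
Hypothesis inv : chain_inv mu g1 f s path.
Hypotheses (gs : good K m s) (sM : (nprops s - t0 < M)%N) (t0s : (t0 <= nprops s)%N).
Hypothesis pK : (size path < K1)%N.
Notation g := (proposer path).

Definition next_pot b : R :=
  potential (propose s g b 0) [set mu b] + slow_pot R K K1 M t0 (size path).+1 (nprops s).+1.
Definition same_pot b : R :=
  potential (propose s g b 0) [set g] + slow_pot R K K1 M t0 (size path) (nprops s).+1.

Lemma next_potE b : chain_pot (propose s g b 0) (rcons path b) = next_pot b.
Proof. by rewrite /chain_pot /next_pot nprops_propose size_rcons /proposer map_rcons last_rcons. Qed.

Lemma same_potE b i : chain_pot (propose s g b i) path = same_pot b.
Proof. by rewrite /chain_pot /same_pot nprops_propose potential_propose. Qed.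

Lemma next_pot_ge0 b : 0 <= next_pot b.
Proof. by rewrite -next_potE chain_pot_ge0. Qed.

Lemma same_pot_ge0 b : 0 <= same_pot b.
Proof. by rewrite -(same_potE b 0) chain_pot_ge0. Qed.

(** The potentials propagate by themselves, so a main term [c] is preserved as soon as its drift,
    the sum in the last hypothesis, is not positive. *)
Lemma chain_step (X : profile n -> R) (A B : 'I_n -> R) c :
  (forall b, b \notin props s g -> cexp (propose s g b 0) X <= A b + next_pot b) ->
  (forall b i, b \notin props s g -> (0 < i <= size (recv s b))%N ->
     cexp (propose s g b i) X <= B b + same_pot b) ->
  \sum_(b | b \notin props s g)
     (accept_prob s b * (A b - c) + (1 - accept_prob s b) * (B b - c)) <= 0 ->
  cexp s X <= c + chain_pot s path.
Proof.
move=> hA hB hc; have w := cinv_wf inv; have [_ gn] := good_size n_gt0 mn g gs.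
have ug := wf_props w g.
apply: (@le_trans _ _ (average s g (fun b => A b + next_pot b) (fun b => B b + same_pot b))).
  by apply: cexp_step_le => //; [move=> b; rewrite wf_mem|exact: wf_recv].
rewrite average_add lerD //; first exact: average_le_cst.
rewrite /next_pot /same_pot average_add lerD //; last exact: (slow_pot_step _ gs).
(* [None] is a default for the boy matched to [g], whom she has already approached; it makes [disp]
   avoid [g] for every boy. *)
pose disp b := if mu b == g then None else Some (mu b).
apply: (@le_trans _ _ (average s g
    (fun b => potential (propose s g b 0) (displace [set g] g (disp b)))
    (fun b => potential (propose s g b 0) [set g]))).
  apply: average_le => // b bg; apply: potential_mono.
  have mb : mu b != g.
    by apply: contraNneq bg => <-; rewrite -(wf_mem w) (cinv_mem inv).
  by rewrite /disp (negPf mb) /= finset.sub1set !inE eqxx.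
apply: potential_step => //; rewrite ?inE //.
- by move: sM t0M; lia.
- move=> b; rewrite /disp; have [//|mb] := eqVneq (mu b) g.
  by apply: contraNneq mb => -[->].
move=> b b' h; rewrite /disp; case: eqP => // _ [<-]; case: eqP => // _ [].
by move=> e; apply: (@perm_inj _ mu).
Qed.

End Step.

Lemma period_distinct P k : period P mu k g1 ->
  uniq (traject (succ P mu) (succ P mu g1) k).
Proof.
case/andP; case: k => // k u /eqP e.
rewrite trajectSr -iterSr e -(rot1_cons g1) rot_uniq; exact: u.
Qed.

Lemma chain_dead f s path k b P : chain_inv mu g1 f s path ->
  (size path < k)%N -> b \notin props s (proposer path) ->
  uniq (traject (succ P mu) (succ P mu g1) k) ->
  consistent (propose s (proposer path) b 0) P -> f P -> b \notin path.
Proof.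
move=> inv pk bg u cP fP; have cs := consistent_wf_propose (cinv_wf inv) bg (leq0n _) cP.
have := distinct_path inv (proj1 cs) fP pk u.
by rewrite (accept_succ inv bg cP fP) mem_map //; apply: perm_inj.
Qed.

(* The weights [accept_prob] only decrease, and their sum drops by at most 1 per
   proposal, so that the proposal that is accepted goes to [b1] with probability
   at most [alpha * accept_prob s b1], whatever the time. *)
Lemma chain_upper k s0 alpha : (0 < k <= K1)%N -> 0 <= alpha ->
  1 <= alpha * (total_accept R s0 - (M + m)%:R) ->
  forall s path, chain_inv mu g1 (fun P => period P mu k g1) s path ->
  (size path < k)%N -> (t0 <= nprops s <= t0 + M)%N ->
  total_accept R s0 - (nprops s - t0)%:R <= total_accept R s ->
  cexp s (fun P => (period P mu k g1)%:R) <= alpha * accept_prob s b1 + chain_pot s path.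
Proof.
move=> /andP[k0 kK] al0 al1 s path.
have [d] := ubnP (M - (nprops s - t0))%N; elim: d s path => // d IHd s path dM inv pk.
move=> /andP[t0s sM] totS.
have le1 : cexp s (fun P => (period P mu k g1)%:R) <= (1 : R).
  by apply: cexp_le => // P _; case: (period _ _ _ _).
have aw0 : 0 <= alpha * accept_prob s b1 by rewrite mulr_ge0 // ltW // accept_prob_gt0.
have [/(chain_pot_ge1 path) p1|] := boolP (~~ good K m s || (M <= nprops s - t0)%N).
  by apply: (le_trans le1); rewrite ler_wpDl.
rewrite negb_or negbK -ltnNge => /andP[gs sM']; have w := cinv_wf inv.
set g := proposer path.
have IH b i path' : b \notin props s g -> (i <= size (recv s b))%N ->
   chain_inv mu g1 (fun P => period P mu k g1) (propose s g b i) path' -> (size path' < k)%N ->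
   cexp (propose s g b i) (fun P => (period P mu k g1)%:R) <=
   alpha * accept_prob s b1 + chain_pot (propose s g b i) path'.
  move=> bg ib inv' pk'.
  apply: (@le_trans _ _ (alpha * accept_prob (propose s g b i) b1 + chain_pot (propose s g b i) path')).
    apply: IHd; rewrite // nprops_propose; [lia|by apply/andP; split; lia|].
    have /andP[tp _] := total_accept_propose R s g b i; apply: le_trans tp.
    by rewrite subSn // -natr1 opprD addrA lerD2r.
  by rewrite lerD2r ler_wpM2l // accept_prob_propose.
have [gm gn] := good_size n_gt0 mn g gs.
(* Acceptances contradicting the event have conditional expectation 0, so any nonnegative value is
   allowed for them. Before the last step the bound itself is chosen, which leaves no drift
   there. *)
pose A b : R := (((size path).+1 == k) && (b == b1))%:R
   + ((size path).+1 != k)%:R * (alpha * accept_prob s b1).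
apply: (chain_step inv gs sM' t0s (leq_trans pk kK) (A := A) (B := fun=> alpha * accept_prob s b1)).
- move=> b bg; have A0 : 0 <= A b by rewrite /A addr_ge0 // mulr_ge0.
  have [fresh|stale] := boolP [&& b \notin b1 :: path & (size path).+1 != k].
    case/andP: fresh => bp kn; rewrite -next_potE.
    have := IH b 0%N (rcons path b) bg (leq0n _) (chain_accept inv bg bp).
    rewrite size_rcons ltn_neqAle kn pk => /(_ isT) h; apply: (le_trans h).
    by rewrite lerD2r /A kn mul1r ler_wpDl.
  have [/andP[/eqP kE /eqP bE]|nclose] := boolP (((size path).+1 == k) && (b == b1)).
    apply: (@le_trans _ _ 1).
      by apply: cexp_le => // P _; case: (period _ _ _ _).
    by rewrite /A kE bE !eqxx mul0r addr0 lerDl next_pot_ge0.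
  apply: (@le_trans _ _ 0); last by rewrite addr_ge0 ?next_pot_ge0.
  apply: cexp_le => // P cP; case fP: (period P mu k g1) => //; exfalso.
  have tr := accept_track inv bg cP fP.
  have bpath := chain_dead inv pk bg (period_distinct fP) cP fP.
  have [kE|kn] := eqVneq (size path).+1 k.
    case/andP: fP => _; rewrite -kE.
    have -> : iter (size path).+1 (succ P mu) g1 = mu b.
      by have := congr1 (last g1) tr; rewrite trajectSr !last_rcons.
    move=> /eqP mb; move: nclose; rewrite kE eqxx /= /boy_of -mb permK eqxx //.
  move: stale; rewrite kn andbT inE negb_or bpath andbT negbK => /eqP bE.
  have kp : ((size path).+2 <= k)%N by rewrite ltn_neqAle kn.
  case/andP: fP => u _; have : uniq (traject (succ P mu) g1 (size path).+2).
    by rewrite -(@take_traject _ _ k _ _ kp) take_uniq.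
  by rewrite tr bE permKV /= mem_rcons inE eqxx.
- move=> b i bg i0; have /andP[_ ib] := i0; rewrite -(same_potE s path b i).
  apply: IH => //; apply: (chain_reject_distinct inv bg i0 pk).
  by move=> P _; apply: period_distinct.
set c := alpha * accept_prob s b1.
(* Only the last step has a drift: the weight of [b1] against [c] times the weight of all boys still
   open to [g]. *)
apply: (@le_trans _ _ (\sum_(b | b \notin props s g)
  ((size path).+1 == k)%:R * (accept_prob s b * (b == b1)%:R - c * accept_prob s b))).
  rewrite le_eqVlt; apply/orP; left; apply/eqP; apply: eq_bigr => b _; rewrite /A -/c.
  by case: ((size path).+1 == k) => /=; case: (b == b1) => /=; ring.
rewrite -mulr_sumr mulr_ge0_le0 // sumrB subr_le0 -mulr_sumr.
apply: (@le_trans _ _ (accept_prob s b1)).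
  rewrite big_mkcond (bigD1 b1) //= big1 => [|b /negPf ->]; last by rewrite mulr0 if_same.
  by rewrite eqxx addr0; case: ifP => _; rewrite ?mulr1 // ltW // accept_prob_gt0.
rewrite /c mulrAC -[leLHS]mul1r ler_wpM2r ?(ltW (accept_prob_gt0 _ _ _)) //.
apply: (le_trans al1); rewrite ler_wpM2l //.
apply: le_trans (sum_accept_notin R s (props s g)).
rewrite natrD opprD addrA lerB ?ler_nat //; apply: le_trans totS.
by rewrite lerD2l lerN2 ler_nat ltnW.
Qed.

(* Birthday argument: after [hf] steps an acceptance comes from a boy of the path
   with probability at least [1 - q]. *)
Lemma chain_long hf q : 0 <= q <= 1 ->
  (1 - q) * n%:R <= (hf%:R - m%:R) / K.+1%:R ->
  forall s path, chain_inv mu g1 (fun P => uniq (traject (succ P mu) g1 K1.+1)) s path ->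
  (size path <= K1)%N -> (t0 <= nprops s <= t0 + M)%N ->
  cexp s (fun P => (uniq (traject (succ P mu) g1 K1.+1))%:R)
    <= q ^+ (K1 - maxn (size path) hf) + chain_pot s path.
Proof.
move=> /andP[q0 q1] hq s path.
have [d] := ubnP (M - (nprops s - t0))%N; elim: d s path => // d IHd s path dM inv pk.
move=> /andP[t0s sM].
pose f : pred (profile n) := fun P => uniq (traject (succ P mu) g1 K1.+1).
have le1 s' : cexp s' (fun P => (f P)%:R) <= (1 : R).
  by apply: cexp_le => // P _; case: (f P).
have v0 j : 0 <= q ^+ (K1 - maxn j hf) by rewrite exprn_ge0.
have [/(chain_pot_ge1 path) p1|] := boolP (~~ good K m s || (M <= nprops s - t0)%N).
  by apply: (le_trans (le1 s)); rewrite ler_wpDl.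
rewrite negb_or negbK -ltnNge => /andP[gs sM']; have w := cinv_wf inv.
have [kp|pk'] := leqP K1 (size path).
  have -> : (K1 - maxn (size path) hf = 0)%N by lia.
  by apply: (le_trans (le1 s)); rewrite expr0 lerDl chain_pot_ge0.
set g := proposer path.
have IH b i path' : b \notin props s g -> (i <= size (recv s b))%N ->
   chain_inv mu g1 f (propose s g b i) path' -> (size path' <= K1)%N ->
   cexp (propose s g b i) (fun P => (f P)%:R) <=
   q ^+ (K1 - maxn (size path') hf) + chain_pot (propose s g b i) path'.
  move=> bg ib inv' pk''.
  by apply: IHd; rewrite // nprops_propose; [lia|apply/andP; split; lia].
have [gm gn] := good_size n_gt0 mn g gs.
set j := size path in pk pk' *.
pose A b : R := (b \notin b1 :: path)%:R * q ^+ (K1 - maxn j.+1 hf).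
have fdist P : f P -> uniq (traject (succ P mu) (succ P mu g1) K1).
  by rewrite /f trajectS /= => /andP[].
apply: (chain_step inv gs sM' t0s pk' (A := A) (B := fun=> q ^+ (K1 - maxn j hf))).
- move=> b bg.
  have [bp|bp] := boolP (b \notin b1 :: path).
    rewrite -next_potE /A bp mul1r.
    by have := IH b 0%N (rcons path b) bg (leq0n _) (chain_accept inv bg bp);
       rewrite size_rcons => /(_ pk').
  apply: (@le_trans _ _ 0); last by rewrite /A (negPf bp) mul0r add0r next_pot_ge0.
  apply: cexp_le => // P cP; rewrite -/(f P); case fP: (f P) => //; exfalso.
  have tr := accept_track inv bg cP fP.
  have bpath := chain_dead inv pk' bg (fdist _ fP) cP fP.
  have := fP; rewrite /f -(cat_take_drop (size path).+2 (traject _ _ _)).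
  rewrite take_traject // cat_uniq tr => /andP[+ _].
  move: bp; rewrite inE (negPf bpath) orbF negbK => /eqP ->.
  by rewrite permKV /= mem_rcons inE eqxx.
- move=> b i bg i0; have /andP[_ ib] := i0; rewrite -(same_potE s path b i).
  apply: (IH b i path bg ib _ pk); apply: (chain_reject_distinct inv bg i0 pk').
  by move=> P _; apply: fdist.
set v := q ^+ (K1 - maxn j hf); set v' := q ^+ (K1 - maxn j.+1 hf) in A *.
have [jh|hj] := ltnP j hf.
  have vE : v' = v by rewrite /v /v'; congr (q ^+ _); lia.
  rewrite sumr_le0 // => b _; rewrite subrr mulr0 addr0 mulr_ge0_le0 ?(ltW (accept_prob_gt0 _ _ _)) //.
  by rewrite subr_le0 /A -/v' vE ler_piMl ?v0 // lern1; case: (_ \notin _).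
(* From [hf] steps on, at least [hf - m] boys of [b1 :: path] are still open to [g], each accepting
   with probability at least 1/(K+1); the total of all acceptance probabilities is at most n. *)
have vE : v = q * v' by rewrite /v /v' -exprS; congr (q ^+ _); lia.
rewrite vE (eq_bigr (fun b => v' * ((1 - q) * accept_prob s b -
    accept_prob s b * (b \in b1 :: path)%:R))); last first.
  move=> b _; rewrite subrr mulr0 addr0 /A -/v'.
  by case: (b \in _) => /=; ring.
rewrite -mulr_sumr mulr_ge0_le0 ?v0 // sumrB subr_le0 -mulr_sumr.
apply: (@le_trans _ _ ((1 - q) * n%:R)).
  rewrite ler_wpM2l ?subr_ge0 // -[in leRHS](card_ord n) -sum1_card natr_sum.
  by rewrite big_mkcond; apply: ler_sum => b _; case: ifP; rewrite ?accept_prob_le1.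
apply: (le_trans hq).
apply: (@le_trans _ _ (\sum_(b | b \notin props s g) (K.+1%:R)^-1 * (b \in b1 :: path)%:R)).
  rewrite -mulr_sumr mulrC ler_wpM2l ?invr_ge0 //.
  apply: le_trans (sum_notin_ge R (props s g) (cinv_uniq inv)).
  by rewrite lerB ?ler_nat //= ltnW.
by apply: ler_sum => b _; rewrite ler_wpM2r // (accept_prob_ge R b gs).
Qed.

(* Only the histories in which [b1] and the boys of the path get no extra
   proposal, and no girl of the chain has approached [b1] before, are counted. *)
Lemma chain_lower k s0 q beta : (0 < k <= K1)%N -> 0 <= beta -> 0 <= q <= 1 ->
  beta * (total_accept R s0 + k%:R) <= 1 ->
  (K + k)%:R <= (1 - q) * ((n%:R - (m + k)%:R) / K.+1%:R) ->
  forall s path, chain_inv mu g1 predT s path ->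
  (size path < k)%N -> (t0 <= nprops s <= t0 + M)%N ->
  total_accept R s <= total_accept R s0 ->
  recv s b1 = recv s0 b1 -> (path == [::]) && (1 < k)%N || (proposer path \notin recv s b1) ->
  cexp s (fun P => - (period P mu k g1)%:R) <=
    - (q ^+ (k.-1 - size path) * (beta * accept_prob s0 b1)) + chain_pot s path.
Proof.
move=> /andP[k0 kK] be0 /andP[q0 q1] be1 hq s path.
have [d] := ubnP (M - (nprops s - t0))%N; elim: d s path => // d IHd s path dM inv pk.
move=> /andP[t0s sM] totS rb1 gb1.
set c := beta * accept_prob s0 b1.
have c0 : 0 <= c by rewrite mulr_ge0 // ltW // accept_prob_gt0.
have c1 : c <= 1.
  apply: le_trans be1; rewrite ler_wpM2l // ler_wpDr //.
  rewrite /total_accept (bigD1 b1) //= lerDl; apply: sumr_ge0 => b _.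
  exact/ltW/accept_prob_gt0.
have vc e : 0 <= q ^+ e * c <= 1.
  by rewrite mulr_ge0 ?exprn_ge0 //= mulr_ile1 ?exprn_ge0 ?exprn_ile1.
have le0 s' : cexp s' (fun P => - (period P mu k g1)%:R) <= (0 : R).
  by apply: cexp_le => // P _; rewrite oppr_le0.
have [/(chain_pot_ge1 path) p1|] := boolP (~~ good K m s || (M <= nprops s - t0)%N).
  apply: (le_trans (le0 s)); rewrite addrC subr_ge0; apply: le_trans p1.
  by case/andP: (vc (k.-1 - size path)%N).
rewrite negb_or negbK -ltnNge => /andP[gs sM']; have w := cinv_wf inv.
set g := proposer path in gb1 *.
have [gm gn] := good_size n_gt0 mn g gs.
have b1P : accept_prob s b1 = accept_prob s0 b1 by rewrite -[LHS]/((size (recv s b1)).+1%:R^-1) rb1.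
have IH b i path' : b \notin props s g -> b != b1 -> (i <= size (recv s b))%N ->
   chain_inv mu g1 predT (propose s g b i) path' -> (size path' < k)%N ->
   (path' == [::]) && (1 < k)%N || (proposer path' \notin recv s b1) ->
   cexp (propose s g b i) (fun P => - (period P mu k g1)%:R) <=
   - (q ^+ (k.-1 - size path') * c) + chain_pot (propose s g b i) path'.
  move=> bg bb1 ib inv' pk' gb'.
  have rb' : recv (propose s g b i) b1 = recv s b1.
    by rewrite /= eq_sym (negPf bb1).
  apply: (IHd _ _ _ inv' pk').
  - by move: dM sM' t0s; rewrite nprops_propose; clear; lia.
  - by move: sM' t0s; rewrite nprops_propose; clear; lia.
  - by have /andP[_ tp] := total_accept_propose R s g b i; exact: le_trans tp totS.
  - by rewrite rb'.
  by rewrite rb'.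
pose fresh b := b \notin b1 :: path.
(* Histories that are not counted get the value 0, an upper bound for the negated indicator. *)
pose A b : R := if (size path).+1 == k then - (b == b1)%:R
  else - ((fresh b && (mu b \notin recv s b1))%:R * (q ^+ (k.-1 - (size path).+1) * c)).
pose B b : R := - ((fresh b)%:R * (q ^+ (k.-1 - size path) * c)).
have iterb1 b P : b \notin props s g -> consistent (propose s g b 0) P ->
    iter (size path).+1 (succ P mu) g1 = mu b.
  move=> bg cP; have tr := accept_track inv bg cP isT.
  by have := congr1 (last g1) tr; rewrite trajectSr !last_rcons.
apply: (chain_step inv gs sM' t0s (leq_trans pk kK) (A := A) (B := B)).
- move=> b bg; rewrite /A.
  have [kE|kn] := eqVneq (size path).+1 k.
    have [bE|_] := eqVneq b b1; last by rewrite oppr0 add0r (le_trans (le0 _)) ?next_pot_ge0.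
    apply: (@le_trans _ _ (-1)); last by rewrite lerDl next_pot_ge0.
    have w' : wf (propose s g b 0) by apply: wf_propose.
    rewrite (cexp_cst (c := -1)) ?wf_weight // => P cP.
    suff -> : period P mu k g1 by [].
    apply/andP; split; last by rewrite -kE (iterb1 b P bg cP) bE permKV.
    have [cs _] := consistent_wf_propose w bg (leq0n _) cP.
    rewrite -kE (cinv_track inv cs isT) -(permKV mu g1) -map_cons map_inj_uniq //.
      exact: cinv_uniq inv.
    exact: perm_inj.
  have [/andP[fb mb]|_] := boolP (fresh b && (mu b \notin recv s b1)); last first.
    by rewrite mul0r oppr0 add0r (le_trans (le0 _)) ?next_pot_ge0.
  rewrite mul1r -next_potE.
  have bb1 : b != b1 by move: fb; rewrite /fresh inE negb_or => /andP[].
  have := IH b 0%N (rcons path b) bg bb1 (leq0n _) (chain_accept inv bg fb).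
  rewrite size_rcons; apply; first by rewrite ltn_neqAle kn.
  by rewrite /proposer map_rcons last_rcons mb orbT.
- move=> b i bg i0; have /andP[_ ib] := i0; rewrite /B.
  have [fb|_] := boolP (fresh b); last first.
    by rewrite mul0r oppr0 add0r (le_trans (le0 _)) ?same_pot_ge0.
  move: fb; rewrite /fresh inE negb_or => /andP[bb1 bp].
  rewrite mul1r -(same_potE s path b i).
  by apply: IH => //; apply: chain_reject.
have [kE|kn] := eqVneq (size path).+1 k.
  (* The starting girl has approached [b1] herself; the clause [1 < k] excludes that she is the one
     to close the cycle. *)
  have b1g : b1 \notin props s g.
    rewrite -(wf_mem w); move: gb1; case/orP => // /andP[/eqP p0 k1].
    by move: k1; rewrite -kE p0.
  have -> : (k.-1 - size path = 0)%N by rewrite -kE subnn.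
  rewrite expr0 mul1r.
  (* At the last step the weight of [b1] must outweigh [c] times the total weight, plus [c] for each
     of the at most [k] boys of [b1 :: path]. *)
  apply: (@le_trans _ _ (\sum_(b | b \notin props s g)
     (c * accept_prob s b + c * (b \in b1 :: path)%:R - accept_prob s b * (b == b1)%:R))).
    apply: ler_sum => b _; rewrite /A /B kE eqxx /fresh.
    have -> : (k.-1 - size path = 0)%N by rewrite -kE subnn.
    have := accept_prob_gt0 R s b; move: (accept_prob s b) => x x0.
    have : 0 <= c * x by rewrite mulr_ge0 // ltW.
    by rewrite expr0; case: (b \in b1 :: path); case: (b == b1) => /=; lra.
  rewrite sumrB subr_le0 big_split /= -!mulr_sumr -mulrDr.
  rewrite [leRHS]big_mkcond [leRHS](bigD1 b1) //= b1g eqxx mulr1 ler_wpDr //.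
    apply: sumr_ge0 => b _; case: ifP => // _; rewrite mulr_ge0 //.
    exact/ltW/accept_prob_gt0.
  rewrite b1P /c mulrAC -[leRHS]mul1r ler_wpM2r ?(ltW (accept_prob_gt0 _ _ _)) //.
  apply: le_trans be1; rewrite ler_wpM2l // lerD //.
    apply: le_trans totS; rewrite /total_accept [leRHS](bigID (fun b => b \notin props s g)) /=.
    by rewrite lerDl; apply: sumr_ge0 => b _; apply/ltW/accept_prob_gt0.
  by apply: le_trans (sum_mem_le _ _ _) _; rewrite ler_nat.
have -> : (k.-1 - size path = (k.-1 - (size path).+1).+1)%N.
  by move: kn pk; clear; lia.
set v := q ^+ (k.-1 - (size path).+1) * c.
have v0 : 0 <= v by case/andP: (vc (k.-1 - (size path).+1)%N).
(* At the other steps at most [K + k] boys are excluded; giving up a factor [q] per acceptance pays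
   for them. *)
apply: (@le_trans _ _ (v * \sum_(b | b \notin props s g)
  ((b \in b1 :: path)%:R + (b \in map (mu^-1)%g (recv s b1))%:R
   - (1 - q) * (accept_prob s b * (fresh b)%:R)))).
  rewrite mulr_sumr; apply: ler_sum => b _; rewrite /A /B (negPf kn).
  have -> : (k.-1 - size path = (k.-1 - (size path).+1).+1)%N.
    by move: kn pk; clear; lia.
  rewrite exprS -!(mulrA q) -/v.
  have -> : (b \in map (mu^-1)%g (recv s b1)) = (mu b \in recv s b1).
    by rewrite -{1}(permK mu b) mem_map //; apply: perm_inj.
  have := accept_prob_gt0 R s b; have := accept_prob_le1 R s b.
  move: (accept_prob s b) => x x1 x0.
  have h1 : 0 <= v * (1 - q) by rewrite mulr_ge0 // subr_ge0.
  have h2 : 0 <= v * (1 - x) by rewrite mulr_ge0 // subr_ge0.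
  by rewrite /fresh; case: (b \in b1 :: path); case: (mu b \in _) => /=; lra.
rewrite mulr_ge0_le0 // sumrB big_split /= subr_le0 -mulr_sumr.
apply: (@le_trans _ _ (K + k)%:R).
  rewrite natrD addrC lerD //; apply: (le_trans (sum_mem_le _ _ _)); rewrite ler_nat //.
  by rewrite size_map; have /andP[/forallP/(_ b1)] := gs.
apply: (le_trans hq); rewrite ler_wpM2l ?subr_ge0 //.
apply: (@le_trans _ _ (\sum_(b | b \notin props s g) (K.+1%:R)^-1 * (fresh b)%:R)); last first.
  by apply: ler_sum => b _; rewrite ler_wpM2r // (accept_prob_ge R b gs).
rewrite -mulr_sumr mulrC ler_wpM2l ?invr_ge0 //.
rewrite (eq_bigr (fun b => 1 - (b \in b1 :: path)%:R)) => [|b _]; last first.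
  by rewrite /fresh; case: (b \in _); rewrite ?subrr ?subr0.
rewrite sumrB sumr_const card_notin ?wf_props // natrB; last exact: ltnW.
rewrite natrD opprD addrA lerB // ?lerD2l ?lerN2 ?ler_nat //.
by apply: le_trans (sum_mem_le _ _ _) _; rewrite ler_nat.
Qed.

End ChainBounds.

(** * Elementary inequalities for powers *)

Section Numerics.
Variable R : realFieldType.
Implicit Type x : R.

Lemma bernoulli x k : -1 <= x -> 1 + k%:R * x <= (1 + x) ^+ k.
Proof.
move=> x1; elim: k => [|k IHk]; first by rewrite mul0r addr0 expr0.
rewrite exprS; apply: (@le_trans _ _ ((1 + x) * (1 + k%:R * x))).
  have : 0 <= k%:R * (x * x) by rewrite mulr_ge0 // -expr2 sqr_ge0.
  by rewrite -natr1; lra.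
by rewrite ler_wpM2l //; lra.
Qed.

Lemma exp_ge2 x k : 0 <= x -> 1 <= k%:R * x -> 2 <= (1 + x) ^+ k.
Proof. by move=> x0 kx; apply: le_trans (bernoulli k _); lra. Qed.

Lemma exp_le_half x k : 0 <= x <= 1 -> 1 <= k%:R * x -> (1 - x) ^+ k <= 2^-1.
Proof.
move=> /andP[x0 x1] kx; have h2 := exp_ge2 x0 kx.
have : (1 - x) ^+ k * (1 + x) ^+ k <= 1.
  rewrite -exprMn exprn_ile1 //; first by rewrite mulr_ge0; lra.
  have : 0 <= x * x by rewrite mulr_ge0.
  by lra.
have a0 : 0 <= (1 - x) ^+ k by rewrite exprn_ge0 // subr_ge0.
have : 0 <= (1 - x) ^+ k * ((1 + x) ^+ k - 2) by rewrite mulr_ge0 // subr_ge0.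
lra.
Qed.

Lemma slackE K : (2 * K.+1)%:R * slack R K = 1.
Proof. by rewrite /slack natrM [2 * _]mulrC mulrACA !mulfV ?mulr1 // pnatr_eq0. Qed.

Lemma base_exp_ge K : 2 ^+ K <= base R K ^+ (2 * K.+1 * K).
Proof.
rewrite exprM lerXn2r ?nnegrE ?ler0n ?base_exp_ge0 //.
by apply: exp_ge2; rewrite ?slackE // ltW // slack_gt0.
Qed.

Lemma slack_exp_le K k : (1 - slack R K) ^+ (2 * K.+1 * k) <= (2 ^+ k)^-1.
Proof.
have s01 : 0 <= slack R K <= 1 by rewrite !ltW ?slack_gt0 ?slack_lt1.
rewrite exprM -exprVn lerXn2r ?nnegrE ?invr_ge0 ?ler0n ?exprn_ge0 ?subr_ge0 //.
  by case/andP: s01.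
by apply: exp_le_half; rewrite ?slackE.
Qed.

(** The exponent is covered by four blocks of length n/4 + 1. Bernoulli's inequality for the inverse
    1 - 2/(n+2) of [growth] bounds each block by 4. *)
Lemma growth_exp_le n : (1 < n)%N -> growth R n ^+ n <= 2 ^+ 8.
Proof.
move=> n1; have n0 : 0 < n%:R :> R by rewrite ltr0n ltnW.
have n2 : 2 <= n%:R :> R by rewrite ler_nat.
set r := (n %/ 4).+1.
have g1 := growth_ge1 R n.
apply: (@le_trans _ _ ((growth R n ^+ r) ^+ 4)).
  rewrite -exprM ler_weXn2l // /r.
  by rewrite mulSn {1}(divn_eq n 4) addnC leq_add2r ltnW // ltn_mod.
have -> : 2 ^+ 8 = (4 : R) ^+ 4 by rewrite (_ : 4 = 2 ^+ 2 :> R) -?exprM //; ring.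
rewrite lerXn2r ?nnegrE ?growth_exp_ge0 //.
pose y : R := 2 / (n%:R + 2).
have gy : growth R n * (1 - y) = 1.
  by rewrite /growth /y; field; apply/andP; split; apply/lt0r_neq0; lra.
have y0 : 0 <= y by rewrite /y divr_ge0 //; lra.
have y1 : y <= 1 by rewrite /y ler_pdivrMr; lra.
have : 1 + r%:R * (- y) <= (1 + - y) ^+ r by apply: bernoulli; lra.
have : 4 * (r%:R * y) <= 3.
  rewrite /y !mulrA ler_pdivrMr; last by lra.
  have : 4 * r%:R <= n%:R + 4 :> R.
    by rewrite -natrM -natrD ler_nat /r; lia.
  lra.
move=> h1 h2; have h3 : 1 / 4 <= (1 - y) ^+ r by lra.
have : growth R n ^+ r * (1 - y) ^+ r = 1 by rewrite -exprMn gy expr1n.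
have G0 := growth_exp_ge0 R n r.
have : 0 <= growth R n ^+ r * ((1 - y) ^+ r - 1 / 4) by rewrite mulr_ge0 // subr_ge0.
lra.
Qed.

End Numerics.

(** * Expected number of cycles *)

Section Totals.
Variables (R : realFieldType) (n : nat).
Implicit Types (g b : 'I_n) (s : state n) (P : profile n) (mu : matching n).
Variables (K m T T1 K1 M : nat).
Hypotheses (n_gt0 : (0 < n)%N) (mn : (m.*2 <= n)%N) (TM : (T1 + M <= T)%N).
Hypothesis dominated : (((M + m) * K.+1).*2 <= n)%N.

Notation potential := (potential R K m T).
Notation accept_prob := (accept_prob R).

Definition harmonic_from2 (k : nat) : R := \sum_(2 <= j < k.+1) j%:R^-1.

Lemma harmonic_from2_ge0 k : 0 <= harmonic_from2 k.
Proof. by apply: sumr_ge0 => j _; rewrite invr_ge0. Qed.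

Variable X : profile n -> R.
Hypothesis X_cycles : forall P mu, is_minimum P (stable_matchings P) mu ->
  X P = #|cycles P mu|%:R.

Definition slow_start : R := 2 ^+ K1 * (1 - slack R K) ^+ M.

Lemma slow_start_ge0 : 0 <= slow_start.
Proof. by rewrite mulr_ge0 ?exprn_ge0 // subr_ge0 ltW // slack_lt1. Qed.

Section Final.
Variables (s : state n) (mu : matching n).
Hypotheses (inv : proposal_inv s) (full : forall b, head_of s b = Some (mu b)).
Hypotheses (gs : good K m s) (sT : (nprops s <= T1)%N).

(** Letting one girl resume makes her count double, which at most doubles [girl_load]. *)
Lemma chain_pot_start g :
  chain_pot R K m T K1 M (nprops s) mu g s [::]
  <= 2 * potential s finset.set0 + slow_start.
Proof.
rewrite /chain_pot /slow_pot subnn !subn0 lerD2r /potential mulrA ler_wpM2r ?growth_exp_ge0 //.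
have L0 := load_ge0 R s; have G0 := girl_load_ge0 R K s finset.set0.
rewrite mulrDr lerD //.
  by rewrite ler_peMl ?ler1n // divr_ge0 // exprn_ge0.
rewrite mulrA ler_wpM2r ?invr_ge0 ?base_exp_ge0 // /girl_load mulr_sumr.
apply: ler_sum => h _; rewrite [leRHS]mulrCA ler_wpM2l ?base_exp_ge0 //.
by rewrite -natrM ler_nat !inE; case: (h == _).
Qed.

Lemma sum_accept_boy_of : \sum_g accept_prob s (boy_of mu g) = total_accept R s.
Proof.
by rewrite /total_accept [RHS](reindex_inj (@perm_inj _ (mu^-1)%g)).
Qed.

Lemma total_accept_ge : n%:R / K.+1%:R <= total_accept R s.
Proof.
rewrite /total_accept -{1}(card_ord n) -sum1_card natr_sum mulr_suml.
by apply: ler_sum => b _; rewrite mul1r (accept_prob_ge R b gs).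
Qed.

Let start_bounds : (nprops s <= nprops s <= nprops s + M)%N.
Proof. by rewrite leqnn leq_addr. Qed.

Let start_horizon : (nprops s + M <= T)%N.
Proof. by apply: leq_trans TM; rewrite leq_add2r. Qed.

Let pot_start := 2 * potential s finset.set0 + slow_start.

(** Summing [alpha * accept_prob] over the starting boys gives W / (W - D), with [D] the possible
    loss of weight. Since W is at least n/(K+1), [dominated] gives 2 D <= W. *)
Lemma final_period_upper k : (0 < k <= K1)%N ->
  \sum_g cexp s (fun P => (period P mu k g)%:R) <=
  1 + ((M + m) * K.+1).*2%:R / n%:R + n%:R * pot_start.
Proof.
move=> kK; set D := ((M + m)%:R : R); set W := total_accept R s.
have n0 : 0 < n%:R :> R by rewrite ltr0n.
have k0 : 0 < K.+1%:R :> R by rewrite ltr0n.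
have Wn : n%:R <= W * K.+1%:R by have := total_accept_ge; rewrite ler_pdivrMr.
have dom : 2 * (D * K.+1%:R) <= n%:R.
  by rewrite /D -!natrM ler_nat mul2n.
have D0 : 0 <= D by rewrite ler0n.
have DW : 2 * D <= W by rewrite -(ler_pM2r k0); apply: le_trans Wn; rewrite -mulrA.
have W0 : 0 < W by rewrite (lt_le_trans _ total_accept_ge) // divr_gt0.
have WD : 0 < W - D by lra.
pose alpha := (W - D)^-1.
have up g : cexp s (fun P => (period P mu k g)%:R) <= alpha * accept_prob s (boy_of mu g) + pot_start.
  have al0 : 0 <= alpha by rewrite invr_ge0 ltW.
  have al1 : 1 <= alpha * (W - D) by rewrite mulVf // gt_eqF.
  have := chain_upper K (m := m) (T := T) (K1 := K1) (M := M) (mu := mu) (g1 := g) n_gt0 mn start_horizon kK al0 al1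
    (chain_start g _ inv full).
  rewrite subnn subr0 => /(_ _ start_bounds (lexx _)) h.
  apply: (le_trans (h _)); first by case/andP: kK.
  by rewrite lerD2l chain_pot_start.
apply: (le_trans (ler_sum _ (fun g _ => up g))).
rewrite big_split /= -mulr_sumr sum_accept_boy_of sumr_const card_ord -[pot_start *+ n]mulr_natl lerD2r.
rewrite -/W mulrC ler_pdivrMr // -muln2 natrM natrM -/D.
set e := _ / n%:R.
have e0 : 2 * (D * K.+1%:R) = e * n%:R by rewrite /e divfK ?gt_eqF // mulrC.
have e_ge0 : 0 <= e by rewrite /e divr_ge0 // mulr_ge0 // mulr_ge0.
have : 2 * D <= e * W.
  rewrite -(ler_pM2r k0); have : e * n%:R <= e * (W * K.+1%:R) by rewrite ler_wpM2l.
  by rewrite -e0; lra.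
have e1 : e <= 1 by rewrite /e ler_pdivrMr // mul1r mulrC.
have : 0 <= (1 - e) * D by rewrite mulr_ge0 // subr_ge0.
lra.
Qed.

Lemma final_upper hf q : (0 < K1)%N -> 0 <= q <= 1 ->
  (1 - q) * n%:R <= (hf%:R - m%:R) / K.+1%:R ->
  cexp s X <= harmonic_from2 K1 * (1 + ((M + m) * K.+1).*2%:R / n%:R) +
    n%:R * q ^+ (K1 - hf) + (harmonic_from2 K1 + 1) * (n%:R * pot_start).
Proof.
move=> K1_gt0 q01 hq.
apply: (@le_trans _ _ (cexp s (fun P =>
    \sum_(2 <= k < K1.+1) k%:R^-1 * (\sum_g (period P mu k g)%:R)
    + \sum_g (uniq (traject (succ P mu) g K1.+1))%:R))).
  apply: cexp_mono => P cP; rewrite (X_cycles (complete_minimum inv full cP)).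
  exact: sum_period_ge.
rewrite cexpD !cexp_sum mulrDl [in leRHS]mul1r addrACA -mulrDr lerD //.
  rewrite /harmonic_from2 mulr_suml ler_sum_nat // => k /andP[k2 kK].
  rewrite cexpZ ler_wpM2l ?invr_ge0 // cexp_sum; apply: final_period_upper.
  by rewrite (ltnW k2) -ltnS.
rewrite -mulrDr; set y := q ^+ _ + _.
have -> : n%:R * y = \sum_(g < n) y by rewrite sumr_const card_ord mulr_natl.
apply: ler_sum => g _.
have := chain_long (K := K) (m := m) (T := T) (K1 := K1) (M := M) (t0 := nprops s) (g1 := g) n_gt0 mn
  start_horizon q01 hq (chain_start g _ inv full) (leq0n _) start_bounds.
rewrite max0n => /le_trans; apply; rewrite lerD2l; exact: chain_pot_start.
Qed.

Lemma final_period_lower k k2 : (0 < k <= k2)%N -> (1 < k)%N -> (k2 <= K1)%N ->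
  ((m + k2).*2 <= n)%N -> (((K + k2) * K.+1).*2 <= n)%N ->
  \sum_g cexp s (fun P => - (period P mu k g)%:R) <=
  - (1 - (((K + k2) * K.+1).*2 * k2 + k2 * K.+1)%:R / n%:R) + n%:R * pot_start.
Proof.
move=> /andP[kp kk2] k1 k2K1 mk2 Kk2.
have n0 : 0 < n%:R :> R by rewrite ltr0n.
have k0 : 0 < K.+1%:R :> R by rewrite ltr0n.
set W := total_accept R s.
have Wn : n%:R <= W * K.+1%:R by have := total_accept_ge; rewrite ler_pdivrMr.
have W0 : 0 < W by rewrite (lt_le_trans _ total_accept_ge) // divr_gt0.
(* At least n/2 boys remain available, each accepting with probability at least 1/(K+1); [d] times
   this is the number [K + k2] of boys that may be excluded. *)
set d : R := ((K + k2) * K.+1).*2%:R / n%:R.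
have d0 : 0 <= d by rewrite divr_ge0.
have d1 : d <= 1 by rewrite ler_pdivrMr // mul1r ler_nat.
pose q := 1 - d.
have q01 : 0 <= q <= 1 by rewrite /q subr_ge0 d1 gerBl.
have kW : 0 < W + k%:R by rewrite ltr_wpDr.
pose beta := (W + k%:R)^-1.
have be0 : 0 <= beta by rewrite invr_ge0 ltW.
have lo g : cexp s (fun P => - (period P mu k g)%:R) <=
    - (q ^+ k.-1 * (beta * accept_prob s (boy_of mu g))) + pot_start.
  have := chain_lower (K := K) (m := m) (T := T) (K1 := K1) (M := M) (t0 := nprops s) (g1 := g) (k := k)
    (q := q) (beta := beta) (s0 := s) (s := s) n_gt0 mn start_horizon _ be0 q01 _ _
    (chain_start g _ inv full) _ start_bounds.
  rewrite subn0 => h; apply: (le_trans (h _ _ _ _ _ _ _)) => //.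
  - by rewrite kp (leq_trans kk2).
  - by rewrite mulVf // gt_eqF.
  - rewrite /q opprB addrC subrK mulrA ler_pdivlMr // /d mulrAC ler_pdivlMr //.
    rewrite -muln2 !natrM.
    have : (K + k)%:R <= (K + k2)%:R :> R by rewrite ler_nat leq_add2l.
    have : n%:R <= 2 * (n%:R - (m + k)%:R) :> R.
      have : (m + k).*2%:R <= n%:R :> R.
        rewrite ler_nat; apply: leq_trans mk2; by rewrite leq_double leq_add2l.
      by rewrite -mul2n natrM; lra.
    move: (n%:R - _) => y hy hK.
    apply: (@le_trans _ _ ((K + k2)%:R * K.+1%:R * n%:R)).
      by rewrite ler_wpM2r // ler_wpM2r.
    by rewrite -[leRHS]mulrA ler_wpM2l // mulr_ge0.
  - by rewrite eqxx k1.
  by rewrite lerD2l chain_pot_start.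
apply: (le_trans (ler_sum _ (fun g _ => lo g))).
rewrite big_split /= sumr_const card_ord -[pot_start *+ n]mulr_natl lerD2r sumrN lerN2.
rewrite -!mulr_sumr sum_accept_boy_of -/W.
have bern : 1 - k2%:R * d <= q ^+ k.-1.
  apply: (@le_trans _ _ (1 - k.-1%:R * d)).
    by rewrite lerD2l lerN2 ler_wpM2r // ler_nat (leq_trans (leq_pred _)).
  by rewrite -mulrN; apply: bernoulli; rewrite lerN2.
have bW : 1 - k2%:R * K.+1%:R / n%:R <= beta * W.
  rewrite /beta [leRHS]mulrC ler_pdivlMr //.
  set e := _ / n%:R.
  have eE : e * n%:R = k2%:R * K.+1%:R by rewrite /e divfK ?gt_eqF.
  have e0 : 0 <= e by rewrite /e divr_ge0 // mulr_ge0.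
  have : k2%:R <= e * W.
    have : e * n%:R <= e * (W * K.+1%:R) by rewrite ler_wpM2l.
    by move=> h; rewrite -(ler_pM2r k0); lra.
  have : k%:R <= k2%:R :> R by rewrite ler_nat.
  have : 0 <= e * k%:R by rewrite mulr_ge0.
  lra.
have bW1 : beta * W <= 1.
  by rewrite /beta mulrC ler_pdivrMr // mul1r lerDl.
have bW0 : 0 <= beta * W by rewrite mulr_ge0 // ltW.
have -> : (((K + k2) * K.+1).*2 * k2 + k2 * K.+1)%:R / n%:R
   = k2%:R * d + k2%:R * K.+1%:R / n%:R :> R.
  by rewrite natrD !natrM /d mulrDl; congr (_ + _); rewrite mulrAC [LHS]mulrC.
apply: (@le_trans _ _ ((1 - k2%:R * d) * (beta * W))); last by rewrite ler_wpM2r.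
have : 0 <= k2%:R * d * (1 - beta * W) by apply: mulr_ge0; [exact: mulr_ge0 | rewrite subr_ge0].
lra.
Qed.

Lemma final_lower k2 : (k2 <= K1)%N ->
  ((m + k2).*2 <= n)%N -> (((K + k2) * K.+1).*2 <= n)%N ->
  cexp s (fun P => - X P) <=
  - (harmonic_from2 k2 * (1 - (((K + k2) * K.+1).*2 * k2 + k2 * K.+1)%:R / n%:R)) +
   harmonic_from2 k2 * (n%:R * pot_start).
Proof.
move=> k2K1 mk2 Kk2.
apply: (@le_trans _ _ (cexp s (fun P =>
    \sum_(2 <= k < k2.+1) k%:R^-1 * (\sum_g - (period P mu k g)%:R)))).
  apply: cexp_mono => P cP; rewrite (X_cycles (complete_minimum inv full cP)).
  rewrite (eq_bigr (fun k => - (k%:R^-1 * (\sum_g (period P mu k g)%:R)))).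
    by rewrite sumrN lerN2 sum_period_le.
  by move=> k _; rewrite sumrN mulrN.
rewrite cexp_sum -mulrN -mulrDr /harmonic_from2 mulr_suml ler_sum_nat // => k /andP[k1 kk2].
rewrite cexpZ ler_wpM2l ?invr_ge0 // cexp_sum; apply: final_period_lower => //.
by rewrite (ltnW k1) -ltnS.
Qed.

End Final.
End Totals.

(** * Unconditional expectation *)

Section Expectation.
Variables (R : realType) (n : nat).
Implicit Types (P : profile n).

Lemma expected_value_cexp (X : profile n -> R) : expected_value X = cexp (init_state n) X.
Proof.
rewrite /expected_value /cexp weight_init mulr_suml.
rewrite [RHS](eq_bigl xpredT) => [|P]; last exact: consistent_init.
apply: eq_bigr => P _; congr (_ * _).
rewrite /profile_mass /uniform_mass !prodr_const card_ord card_prod !card_ffun !card_ord.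
by rewrite natrM !natrX invfM !exprVn.
Qed.

Variables (K m T T1 K1 M : nat).
Hypotheses (n_gt0 : (0 < n)%N) (mn : (m.*2 <= n)%N) (TM : (T1 + M <= T)%N).
Hypothesis dominated : (((M + m) * K.+1).*2 <= n)%N.
Variable X : profile n -> R.
Hypothesis X_cycles : forall P mu, is_minimum P (stable_matchings P) mu ->
  X P = #|cycles P mu|%:R.
Hypothesis X_bounds : forall P, 0 <= X P <= n%:R.

Definition failure : R :=
  (n%:R / 2 ^+ K + (2 * n)%:R / base R K ^+ m) * growth R n ^+ T +
  n%:R * (1 - n%:R^-1) ^+ T1.

Lemma failure_init :
  potential R K m T (init_state n) (singles (init_state n)) + empties_pot R T1 (init_state n)
  <= failure.
Proof.
have -> : empties_pot R T1 (init_state n) = n%:R * (1 - n%:R^-1) ^+ T1.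
  rewrite /empties_pot /nprops /= big1_eq subn0; congr (_%:R * _).
  by rewrite /empties -[RHS]card_ord; apply: eq_card => b; rewrite inE eqxx.
rewrite /failure lerD2r /potential /nprops /= big1_eq subn0.
rewrite ler_wpM2r ?growth_exp_ge0 // lerD //.
  by rewrite /load /= sumr_const card_ord expr0.
rewrite ler_wpM2r ?invr_ge0 ?base_exp_ge0 // /girl_load /=.
apply: (@le_trans _ _ (\sum_(h < n) 2)).
  by apply: ler_sum => h _; rewrite expr0 mul1r ler_nat; case: (_ \in _).
by rewrite sumr_const card_ord -mulrnA.
Qed.

Notation H k := (harmonic_from2 R k).
Notation slow_start := (slow_start R K K1 M).

Lemma expectation_upper hf q : (0 < K1)%N -> 0 <= q <= 1 ->
  (1 - q) * n%:R <= (hf%:R - m%:R) / K.+1%:R ->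
  expected_value X <= H K1 * (1 + ((M + m) * K.+1).*2%:R / n%:R) +
    n%:R * q ^+ (K1 - hf) + (H K1 + 1) * (n%:R * slow_start) +
    2 * n%:R * (H K1 + 1) * failure.
Proof.
move=> K1_gt0 q01 hq; have H0 := harmonic_from2_ge0 R K1.
have s0 := slow_start_ge0 R K K1 M.
have q0 : 0 <= n%:R * q ^+ (K1 - hf) by rewrite mulr_ge0 // exprn_ge0 //; case/andP: q01.
(* [c2] is the coefficient of the potential in [final_upper], and it exceeds n, the crude bound for
   [X]. *)
set c1 := _ + _ + (_ + 1) * _; set c2 := 2 * n%:R * (H K1 + 1).
have c10 : 0 <= c1.
  rewrite /c1; apply: addr_ge0; last by rewrite mulr_ge0 ?addr_ge0 // mulr_ge0.
  by rewrite addr_ge0 // mulr_ge0 // addr_ge0 // divr_ge0.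
have nc2 : n%:R <= c2.
  have : 0 <= n%:R * H K1 by rewrite mulr_ge0.
  by have : 0 <= n%:R :> R by []; rewrite /c2; lra.
have c20 : 0 <= c2 by apply: le_trans nc2.
have T1T : (T1 <= T)%N by apply: leq_trans TM; rewrite leq_addr.
rewrite expected_value_cexp.
apply: (@le_trans _ _ (c1 + c2 * (potential R K m T (init_state n) (singles (init_state n))
   + empties_pot R T1 (init_state n)))); last by rewrite lerD2l ler_wpM2l // failure_init.
apply: proposal_bound => //.
- by rewrite addr_ge0.
- by move=> P; have /andP[_ h] := X_bounds P; apply: (le_trans h); rewrite ler_wpDl.
- move=> s mu inv full sT; have [gs|bad] := boolP (good K m s).
    apply: (le_trans (final_upper n_gt0 mn TM dominated X_cycles inv full gs sT K1_gt0 q01 hq)).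
    rewrite /c1 /c2 -!addrA lerD2l lerD2l.
    by rewrite le_eqVlt; apply/orP; left; apply/eqP; ring.
  have p1 := potential_bad R T finset.set0 bad.
  apply: (@le_trans _ _ n%:R).
    by apply: cexp_le => // P _; case/andP: (X_bounds P).
  rewrite ler_wpDl //; apply: (le_trans nc2); rewrite ler_peMr //.
- exact: proposal_inv_init.
by rewrite /nprops /= big1_eq.
Qed.

Lemma expectation_lower k2 : (k2 <= K1)%N ->
  ((m + k2).*2 <= n)%N -> (((K + k2) * K.+1).*2 <= n)%N ->
  H k2 * (1 - (((K + k2) * K.+1).*2 * k2 + k2 * K.+1)%:R / n%:R) -
    H k2 * (n%:R * slow_start) - 2 * n%:R * (H k2 + 1) * failure <= expected_value X.
Proof.
move=> k2K1 mk2 Kk2; have H0 := harmonic_from2_ge0 R k2.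
have s0 := slow_start_ge0 R K K1 M.
set e := _%:R / n%:R; have e0 : 0 <= e by rewrite divr_ge0.
pose c1 := - (H k2 * (1 - e)) + H k2 * (n%:R * slow_start).
pose c2 : R := 2 * n%:R * (H k2 + 1).
have n1 : 1 <= n%:R :> R by rewrite ler1n.
have c12 : 0 <= c1 + c2.
  have : 0 <= H k2 * e by rewrite mulr_ge0.
  have : 0 <= H k2 * (n%:R * slow_start) by apply: mulr_ge0 => //; apply: mulr_ge0.
  have : 0 <= (n%:R - 1) * H k2 by rewrite mulr_ge0 // subr_ge0.
  rewrite /c1 /c2; lra.
have c20 : 0 <= c2 by rewrite /c2 mulr_ge0 ?addr_ge0 // mulr_ge0.
have T1T : (T1 <= T)%N by apply: leq_trans TM; rewrite leq_addr.
have : expected_value (fun P => - X P) = - expected_value X.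
  by rewrite !expected_value_cexp cexpN.
rewrite -lerN2 => <-; rewrite expected_value_cexp.
apply: (@le_trans _ _ (c1 + c2 * failure)); last first.
  by rewrite /c1 /c2 le_eqVlt; apply/orP; left; apply/eqP; ring.
apply: (@le_trans _ _ (c1 + c2 * (potential R K m T (init_state n) (singles (init_state n))
   + empties_pot R T1 (init_state n)))); last by rewrite lerD2l ler_wpM2l // failure_init.
apply: proposal_bound => //.
- move=> P; apply: le_trans c12.
  by rewrite oppr_le0; case/andP: (X_bounds P).
- move=> s mu inv full sT; have [gs|bad] := boolP (good K m s).
    apply: (le_trans (final_lower n_gt0 mn TM X_cycles inv full gs sT k2K1 mk2 Kk2)).
    rewrite /c1 -/e -!addrA lerD2l /c2.
    have := potential_ge0 R K m T s finset.set0; set p := potential _ _ _ _ _ _ => p0.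
    have : 0 <= n%:R * p by rewrite mulr_ge0.
    lra.
  have p1 := potential_bad R T finset.set0 bad.
  apply: (@le_trans _ _ 0).
    by apply: cexp_le => // P _; rewrite oppr_le0; case/andP: (X_bounds P).
  by apply: (le_trans c12); rewrite lerD2l ler_peMr.
- exact: proposal_inv_init.
by rewrite /nprops /= big1_eq.
Qed.

End Expectation.

(** * Asymptotics *)

Section Asymptotics.
Variable R : realType.

Lemma ln_succ_le (k : nat) : (0 < k)%N -> ln k.+1%:R - ln k%:R <= k%:R^-1 :> R.
Proof.
move=> k0; have kp : (0 : R) < k%:R by rewrite ltr0n.
rewrite -ln_div ?posrE ?ltr0n // -natr1 mulrDl mulfV ?gt_eqF // mul1r le_ln1Dx //.
by rewrite (@lt_le_trans _ _ 0) ?ltrN10 // invr_ge0.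
Qed.

Lemma inv_le_ln_succ (k : nat) : (0 < k)%N -> k.+1%:R^-1 <= ln k.+1%:R - ln k%:R :> R.
Proof.
move=> k0; have kp : (0 : R) < k.+1%:R by rewrite ltr0n.
rewrite -lerN2 opprB -ln_div ?posrE ?ltr0n //.
have -> : k%:R / k.+1%:R = 1 + - k.+1%:R^-1 :> R.
  by rewrite -{1}[k%:R](addrK 1) natr1 mulrBl mulfV ?gt_eqF // mul1r.
by rewrite le_ln1Dx // ltrN2 invf_lt1 // ltr1n.
Qed.

Lemma harmonic_le_ln k : (0 < k)%N -> harmonic_from2 R k <= ln k%:R.
Proof.
case: k => // k _; elim: k => [|k IHk].
  by rewrite /harmonic_from2 big_geq // ln1.
rewrite /harmonic_from2 big_nat_recr //=.
by apply: (le_trans (lerD IHk (inv_le_ln_succ (ltn0Sn k)))); rewrite addrC subrK.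
Qed.

Lemma harmonic_ge_ln k : (0 < k)%N -> ln k.+1%:R - ln 2 <= harmonic_from2 R k.
Proof.
case: k => // k _; elim: k => [|k IHk].
  by rewrite /harmonic_from2 big_geq // subrr.
rewrite /harmonic_from2 big_nat_recr //=.
by apply: le_trans (lerD IHk (ln_succ_le (ltn0Sn k.+1))); rewrite [leRHS]addrC addrA subrK.
Qed.

(** With t = h/20, the power 2^h is at least (t+1)^20, and L <= 40 (t+1) <= (t+1)^2 once t >= 40,
    which L >= 1600 ensures. *)
Lemma pow10_le_half_exp : exists L0, forall L, (L0 <= L)%N -> (L ^ 10 <= 2 ^ uphalf L)%N.
Proof.
exists 1600 => L L0; set h := uphalf L.
have Lh : (L <= 2 * h)%N by rewrite /h; lia.
have h0 : (800 <= h)%N by rewrite /h; lia.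
clearbody h; set t := (h %/ 20)%N.
have ht : (h < 20 * t.+1)%N by rewrite mulnC ltn_ceil.
have t0 : (40 <= t)%N by rewrite /t leq_divRL.
have th : (t * 20 <= h)%N by apply: leq_trunc_div.
apply: (@leq_trans ((2 ^ t) ^ 20)); last by rewrite -expnM leq_pexp2l.
apply: (@leq_trans ((t.+1 ^ 2) ^ 10)); last first.
  by rewrite -expnM leq_exp2r // ltn_expl.
rewrite leq_exp2r //; apply: (leq_trans Lh).
apply: (@leq_trans (40 * t.+1)); first by lia.
by rewrite -mulnn leq_mul2r; lia.
Qed.

(** * Choice of the parameters *)

Section Scales.
Variables (n L : nat).
Hypotheses (nL : (n < 2 ^ L)%N) (Ln : (2 ^ L <= 2 * n)%N) (L100 : (100 <= L)%N).
Let S := (2 ^ uphalf L)%N.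
Hypothesis LS : (L ^ 10 <= S)%N.

(* [L] is about [log2 n] and [S] about [sqrt n].  The growth factor over the whole
   run is at most [2 ^ (40 * L)], which [2 ^ K] beats with a polynomial margin. *)
Let K := (50 * L)%N.
(** Makes [base ^+ m] at least 2^K. *)
Let m := (2 * K.+1 * K)%N.
(** With q = 1 - 1/S the birthday condition becomes n/S <= S; the S L steps after [hf] then give a
    factor at most 2^-L. *)
Let hf := (m + K.+1 * S)%N.
Let K1 := (hf + S * L)%N.
(** Makes (1 - slack)^M at most 2^(-2 K1), against the factor 2^K1 in [slow_start]. *)
Let M := (2 * K.+1 * (2 * K1))%N.
(** Makes (1 - 1/n)^T1 at most 2^(-4 L), hence at most n^-4. *)
Let T1 := (n * (4 * L))%N.
(** The cube leaves room in [lower_le] for the factors [K.+1] and [L] that accompany the square of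
    [K2]. *)
Let K2 := (S %/ L ^ 3)%N.

Let nS : (n <= S * S)%N.
Proof.
apply: ltnW; apply: (leq_trans nL); rewrite -expnD leq_pexp2l //.
by clear; lia.
Qed.

Let Sn : (S * S <= 4 * n)%N.
Proof.
apply: (@leq_trans (2 * 2 ^ L)); last by rewrite (_ : 4 = 2 * 2)%N // -mulnA leq_mul2l.
by rewrite -expnS -expnD leq_pexp2l //; clear; lia.
Qed.

Let L0 : (0 < L)%N. Proof. exact: leq_trans L100. Qed.

Let S_gt0 : (0 < S)%N. Proof. by rewrite expn_gt0. Qed.

Let L_exp i j : (i <= j)%N -> (L ^ i <= L ^ j)%N.
Proof. by move=> ij; rewrite leq_pexp2l. Qed.

Let K_le : (K.+1 <= L ^ 2)%N.
Proof. by rewrite -mulnn /K; apply: (@leq_trans (100 * L)); [lia | rewrite leq_mul2r L100 orbT]. Qed.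

Let m_le : (m <= L ^ 5)%N.
Proof.
rewrite (_ : L ^ 5 = L * L ^ 2 * L ^ 2)%N; last by rewrite -expnS -expnD.
by rewrite leq_mul ?leq_mul ?(ltnW K_le) //; apply: leq_trans L100.
Qed.

Let S_ge i : (i <= 10)%N -> (L ^ i <= S)%N.
Proof. by move=> i10; apply: leq_trans LS; apply: L_exp. Qed.

Let K1_le : (K1 <= L ^ 3 * S)%N.
Proof.
have h1 : (m <= S)%N by apply: leq_trans m_le _; apply: S_ge.
have h2 : (K.+1 * S <= L ^ 2 * S)%N by rewrite leq_mul2r K_le orbT.
apply: (@leq_trans ((1 + L ^ 2 + L) * S)).
  by rewrite /K1 /hf !mulnDl mul1n [(S * L)%N]mulnC; lia.
rewrite leq_mul2r; apply/orP; right.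
have h3 : (100 * (L * L) <= L * (L * L))%N by rewrite leq_mul2r L100 orbT.
have h4 : (L <= L * L)%N by rewrite leq_pmulr.
rewrite (expnS L 2) -mulnn; move: h3 h4 L0; move: (L * (L * L))%N (L * L)%N => y x.
by clear; lia.
Qed.

Let M_le : (M <= 4 * (L ^ 5 * S))%N.
Proof.
apply: (@leq_trans (2 * L ^ 2 * (2 * (L ^ 3 * S)))).
  by rewrite /M leq_mul // leq_mul2l ?K_le ?K1_le orbT.
have -> : (L ^ 5 = L ^ 2 * L ^ 3)%N by rewrite -expnD.
by move: (L ^ 2)%N (L ^ 3)%N => x y; clear; lia.
Qed.

Let big_le_n i : (i <= 8)%N -> (L ^ i * S * L <= n)%N.
Proof.
move=> i8; rewrite -(leq_pmul2l (isT : 0 < 4)%N); apply: leq_trans Sn.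
rewrite mulnAC -expnSr mulnA leq_mul2r; apply/orP; right.
apply: leq_trans LS; rewrite (expnS L 9) leq_mul //; first exact: leq_trans L100.
exact: L_exp.
Qed.

Let D_le : (((M + m) * K.+1).*2 * L <= n)%N.
Proof.
apply: leq_trans (big_le_n (leqnn 8)); rewrite leq_mul2r; apply/orP; right.
have h5 : (1 <= L ^ 5)%N by rewrite expn_gt0 L0.
have h1 : (m <= L ^ 5 * S)%N.
  by apply: (leq_trans m_le); rewrite -{1}[(L ^ 5)%N]muln1 leq_mul2l expn_gt0 orbT.
have h2 : (M + m <= 5 * (L ^ 5 * S))%N by move: M_le h1; clear; lia.
apply: (@leq_trans (5 * (L ^ 5 * S) * L ^ 2).*2); first by rewrite leq_double leq_mul.
rewrite (_ : L ^ 8 = L * (L ^ 5 * L ^ 2))%N; last by rewrite -expnD -expnS.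
have : (100 * (L ^ 5 * L ^ 2 * S) <= L * (L ^ 5 * L ^ 2 * S))%N by rewrite leq_mul2r L100 orbT.
by rewrite -muln2; lia.
Qed.

Let dominated : (((M + m) * K.+1).*2 <= n)%N.
Proof. by apply: leq_trans D_le; rewrite -{1}[X in (X <= _)%N]muln1 leq_mul2l L0 orbT. Qed.

Let n_gt0 : (0 < n)%N.
Proof. by apply: leq_trans (big_le_n (leq0n 8)); rewrite !muln_gt0 expn_gt0 S_gt0 L0. Qed.

Let S_le_n : (L ^ 2 * S * 4 <= n)%N.
Proof.
apply: leq_trans (big_le_n (isT : 2 <= 8)%N).
by rewrite leq_mul2l; apply/orP; right; apply: leq_trans L100.
Qed.

Let m2n : (m.*2 <= n)%N.
Proof.
apply: leq_trans dominated; rewrite leq_double.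
by apply: (@leq_trans (M + m)); rewrite ?leq_addl // leq_pmulr.
Qed.

Let MnL : (M <= n * L)%N.
Proof.
apply: (@leq_trans (M + m)); first exact: leq_addr.
apply: (@leq_trans n); last by rewrite leq_pmulr.
apply: leq_trans dominated; rewrite -addnn; apply: leq_trans (leq_addr _ _).
by rewrite leq_pmulr.
Qed.

Let L_le_n : (L <= n)%N.
Proof. by apply: leq_trans (big_le_n (leq0n 8)); rewrite leq_pmull // muln_gt0 S_gt0 expn_gt0 L0. Qed.

Let K1_le_n : (K1 <= n)%N.
Proof.
apply: (leq_trans K1_le); apply: leq_trans (big_le_n (isT : 3 <= 8)%N).
by rewrite leq_pmulr.
Qed.

Let K1_ge : (2 * L <= K1)%N.
Proof.
rewrite /K1 /hf; apply: leq_trans (leq_addl _ _); rewrite leq_mul2r; apply/orP; right.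
apply: leq_trans (S_ge (isT : 1 <= 10)%N); rewrite expn1; exact: leq_trans L100.
Qed.

Let K2_le : (K2 * L ^ 3 <= S)%N. Proof. exact: leq_trunc_div. Qed.

Let K2S : (K2 <= S)%N. Proof. exact: leq_div. Qed.

Let K2_ge : (L ^ 2 <= K2)%N.
Proof. by rewrite /K2 leq_divRL ?expn_gt0 ?L0 // -expnD; apply: S_ge. Qed.

Let K2K1 : (K2 <= K1)%N.
Proof.
apply: (leq_trans K2S); rewrite /K1; apply: leq_trans (leq_addl _ _).
by rewrite leq_pmulr.
Qed.

Let mK2 : ((m + K2).*2 <= n)%N.
Proof.
apply: leq_trans S_le_n; have h1 : (m <= S)%N by apply: leq_trans m_le _; apply: S_ge.
have h2 : (1 * S <= L ^ 2 * S)%N by rewrite leq_mul2r expn_gt0 L0 orbT.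
by move: h1 h2 K2S; rewrite mul1n -addnn; clear; lia.
Qed.

Let KK2 : (K <= K2)%N.
Proof. by apply: leq_trans K2_ge; apply: leq_trans K_le. Qed.

Let KK2n : (((K + K2) * K.+1).*2 <= n)%N.
Proof.
apply: leq_trans S_le_n; apply: (@leq_trans ((S + S) * L ^ 2).*2).
  by rewrite leq_double leq_mul // leq_add // (leq_trans KK2).
by rewrite -muln2 mulnDl [(S * _)%N]mulnC; lia.
Qed.

Let lower_le : ((((K + K2) * K.+1).*2 * K2 + K2 * K.+1) * L <= n)%N.
Proof.
rewrite -(leq_pmul2l (isT : 0 < 4)%N).
have h1 : (L ^ 3 * K2 * (L ^ 3 * K2) <= S * S)%N.
  by rewrite leq_mul // mulnC.
apply: leq_trans (leq_trans h1 Sn).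
have h2 : ((K + K2) * K.+1 <= (2 * K2) * L ^ 2)%N.
  by rewrite leq_mul // mul2n -addnn leq_add2r.
have h3 : (K2 * K.+1 <= K2 * (K2 * L ^ 2))%N.
  rewrite leq_mul2l; apply/orP; right; apply: (leq_trans K_le).
  by rewrite leq_pmull // (leq_trans _ K2_ge) // expn_gt0 L0.
apply: (@leq_trans (4 * (5 * (K2 * (K2 * L ^ 2)) * L))).
  rewrite leq_mul2l /= leq_mul2r; apply/orP; right.
  have : (((K + K2) * K.+1).*2 * K2 <= ((2 * K2) * L ^ 2).*2 * K2)%N.
    by rewrite leq_mul2r leq_double h2 orbT.
  by move: h3; rewrite -!muln2; clear; lia.
have h4 : (100 * (L ^ 2 * (K2 * K2) * L) <= L ^ 3 * (L ^ 2 * (K2 * K2) * L))%N.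
  rewrite leq_mul2r; apply/orP; right; apply: (leq_trans L100).
  by rewrite -{1}[L]expn1; apply: L_exp.
apply: leq_trans (leq_trans _ h4) _; first by clear; lia.
by rewrite expnS; clear; lia.
Qed.

Let Lr : 0 < L%:R :> R. Proof. by rewrite ltr0n. Qed.

Let nr : 0 < n%:R :> R. Proof. by rewrite ltr0n. Qed.

Let n_exp i : n%:R ^+ i <= 2 ^+ (i * L) :> R.
Proof.
rewrite mulnC exprM lerXn2r ?nnegrE // -natrX ler_nat; exact: ltnW.
Qed.

Let H_le k : (0 < k)%N -> (k <= n)%N -> harmonic_from2 R k <= L%:R.
Proof.
move=> k0 kn; apply: (le_trans (harmonic_le_ln k0)).
apply: (@le_trans _ _ (ln (2 ^+ L))).
  rewrite ler_ln ?posrE ?ltr0n ?exprn_gt0 // -natrX ler_nat.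
  exact: leq_trans kn (ltnW nL).
rewrite lnXn // -[L%:R]mulr1 mulr_natl lerMn2r.
have : ln (1 + 1 : R) <= 1 by rewrite le_ln1Dx // (@lt_trans _ _ 0) ?ltrN10.
by move=> ->; rewrite orbT.
Qed.

Let failure_le : failure R n K m (T1 + M) T1 <= 4 * n%:R / n%:R ^+ 4.
Proof.
have n1 : (1 < n)%N by apply: leq_trans L_le_n; apply: leq_trans L100.
(* [T1 + M] is at most 5 n L, and n steps cost at most 2^8. *)
have gT : growth R n ^+ (T1 + M) <= 2 ^+ (40 * L).
  apply: (@le_trans _ _ (growth R n ^+ (n * (5 * L)))).
    rewrite ler_weXn2l ?growth_ge1 //; move: MnL; rewrite /T1; clear; lia.
  rewrite exprM (_ : 40 * L = 8 * (5 * L))%N; last by rewrite mulnA.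
  by rewrite [leRHS]exprM lerXn2r ?nnegrE ?growth_exp_ge0 ?exprn_ge0 ?growth_exp_le.
have bm : (base R K ^+ m)^-1 <= (2 ^+ K)^-1.
  by rewrite lef_pV2 ?posrE ?base_exp_gt0 ?exprn_gt0 // base_exp_ge.
have n4 : (2 ^+ (4 * L))^-1 <= (n%:R ^+ 4)^-1 :> R.
  by rewrite lef_pV2 ?posrE ?exprn_gt0 // n_exp.
have first : (n%:R / 2 ^+ K + (2 * n)%:R / base R K ^+ m) * growth R n ^+ (T1 + M)
    <= 3 * n%:R / n%:R ^+ 4.
  apply: (@le_trans _ _ ((3 * n%:R / 2 ^+ K) * 2 ^+ (40 * L))).
    apply: ler_pM => //.
    - by rewrite addr_ge0 // mulr_ge0 // invr_ge0 ?base_exp_ge0 ?exprn_ge0.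
    - exact: growth_exp_ge0.
    apply: (@le_trans _ _ (n%:R / 2 ^+ K + (2 * n)%:R / 2 ^+ K)).
      by rewrite lerD2l ler_wpM2l.
    by rewrite natrM le_eqVlt; apply/orP; left; apply/eqP; ring.
  rewrite -mulrA ler_wpM2l ?mulr_ge0 //.
  apply: le_trans n4; rewrite /K (_ : 50 * L = 40 * L + 10 * L)%N; last first.
    by rewrite -mulnDl.
  rewrite exprD invfM mulrC mulrA mulfV ?mul1r ?gt_eqF ?exprn_gt0 //.
  rewrite lef_pV2 ?posrE ?exprn_gt0 // ler_weXn2l ?ler1n //.
  by rewrite leq_mul2r orbT.
have second : n%:R * (1 - n%:R^-1) ^+ T1 <= n%:R / n%:R ^+ 4 :> R.
  rewrite ler_wpM2l //; apply: le_trans n4.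
  rewrite /T1 exprM -exprVn lerXn2r ?nnegrE ?invr_ge0 ?exprn_ge0 ?subr_ge0 //.
    by rewrite invf_le1 // ler1n.
  apply: exp_le_half; last by rewrite mulfV ?gt_eqF.
  by rewrite invr_ge0 ler0n invf_le1 // ler1n.
rewrite /failure; apply: (le_trans (lerD first second)).
by rewrite -mulrDl le_eqVlt; apply/orP; left; apply/eqP; congr (_ / _); ring.
Qed.

Let failure_term h : 0 <= h <= L%:R ->
  2 * n%:R * (h + 1) * failure R n K m (T1 + M) T1 <= 16.
Proof.
move=> /andP[h0 hL].
have h1 : h + 1 <= 2 * n%:R.
  have : L%:R <= n%:R :> R by rewrite ler_nat L_le_n.
  have : 1 <= n%:R :> R by rewrite ler1n.
  lra.
have f0 : 0 <= 2 * n%:R * (h + 1) by rewrite !mulr_ge0 ?addr_ge0.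
apply: (le_trans (ler_wpM2l f0 failure_le)).
rewrite mulrA ler_pdivrMr ?exprn_gt0 //.
apply: (@le_trans _ _ (2 * n%:R * (2 * n%:R) * (4 * n%:R))).
  by rewrite ler_wpM2r ?mulr_ge0 // ler_wpM2l ?mulr_ge0.
have : 16 * n%:R ^+ 3 <= 16 * n%:R ^+ 4 :> R.
  by rewrite ler_wpM2l // ler_weXn2l // ler1n.
apply: le_trans; rewrite le_eqVlt; apply/orP; left; apply/eqP; ring.
Qed.

Let slow_term h : 0 <= h <= L%:R -> h * (n%:R * slow_start R K K1 M) <= 1.
Proof.
move=> /andP[h0 hL].
have s1 : slow_start R K K1 M <= (2 ^+ K1)^-1.
  rewrite /slow_start /M -[leRHS]mul1r.
  apply: (le_trans (ler_wpM2l _ (slack_exp_le R K (2 * K1)))); first by rewrite exprn_ge0.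
  by rewrite mul2n -addnn exprD invfM mulrA mulfV ?gt_eqF ?exprn_gt0.
have s2 : slow_start R K K1 M <= (n%:R ^+ 2)^-1.
  apply: (le_trans s1); rewrite lef_pV2 ?posrE ?exprn_gt0 //.
  by apply: (le_trans (n_exp 2)); rewrite ler_weXn2l ?ler1n.
apply: (@le_trans _ _ (n%:R * (n%:R / n%:R ^+ 2))).
  apply: ler_pM => //; first by rewrite mulr_ge0 // slow_start_ge0.
    by apply: (le_trans hL); rewrite ler_nat L_le_n.
  by rewrite ler_wpM2l.
by rewrite mulrA -expr2 mulfV ?gt_eqF ?exprn_gt0.
Qed.

Variable X : profile n -> R.
Hypothesis X_cycles : forall P mu, is_minimum P (stable_matchings P) mu ->
  X P = #|cycles P mu|%:R.
Hypothesis X_bounds : forall P, 0 <= X P <= n%:R.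

Let ln_n_S : 2^-1 * ln n%:R <= ln S%:R :> R.
Proof.
have : ln n%:R <= ln (S * S)%:R :> R by rewrite ler_ln ?posrE ?ltr0n ?muln_gt0 ?S_gt0 // ler_nat.
rewrite natrM lnM ?posrE ?ltr0n ?S_gt0 //; lra.
Qed.

Let ln_S_n : ln S%:R <= 2^-1 * ln n%:R + 2 :> R.
Proof.
have : ln (S * S)%:R <= ln (4 * n)%:R :> R.
  by rewrite ler_ln ?posrE ?ltr0n ?muln_gt0 ?S_gt0 // ler_nat.
rewrite !natrM !lnM ?posrE ?ltr0n ?S_gt0 //.
have : ln (1 + 3 : R) <= 3 by rewrite le_ln1Dx // (@lt_trans _ _ 0) ?ltrN10.
rewrite (_ : 1 + 3 = 4); last by ring.
lra.
Qed.

Let ln_L3 : ln (L ^ 3)%:R = 3 * ln L%:R :> R.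
Proof. by rewrite natrX lnXn // mulr_natl. Qed.

(** [K1] is at most L^3 S, whence the term 3 ln L; all corrections are bounded by constants. *)
Lemma params_upper : expected_value X <= 2^-1 * ln n%:R + 3 * ln L%:R + 30.
Proof.
have S0 : 0 < S%:R :> R by rewrite ltr0n S_gt0.
have K10 : (0 < K1)%N by apply: leq_trans K1_ge; rewrite muln_gt0.
have H0 := harmonic_from2_ge0 R K1; have HL := H_le K10 K1_le_n.
have q01 : 0 <= 1 - (S%:R^-1 : R) <= 1.
  by rewrite subr_ge0 invf_le1 // ler1n S_gt0 gerBl invr_ge0 ltW.
have hq : (1 - (1 - S%:R^-1)) * n%:R <= (hf%:R - m%:R) / K.+1%:R :> R.
  rewrite opprB addrC subrK mulrC ler_pdivrMr // /hf natrD addrC addKr natrM.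
  by rewrite [_ * S%:R / _]mulrAC mulfV ?pnatr_eq0 // mul1r -natrM ler_nat.
have := expectation_upper n_gt0 m2n (leqnn (T1 + M)) dominated X_cycles X_bounds K10 q01 hq.
move=> /le_trans; apply.
have h1 : harmonic_from2 R K1 * (1 + ((M + m) * K.+1).*2%:R / n%:R) <= ln K1%:R + 1.
  rewrite mulrDr mulr1 lerD ?harmonic_le_ln //.
  apply: (@le_trans _ _ (L%:R * (((M + m) * K.+1).*2%:R / n%:R))).
    by rewrite ler_wpM2r // divr_ge0.
  by rewrite mulrA ler_pdivrMr // mul1r -natrM ler_nat mulnC.
have h2 : n%:R * (1 - S%:R^-1) ^+ (K1 - hf) <= 1 :> R.
  rewrite /K1 addKn exprM.
  apply: (@le_trans _ _ (n%:R * (2^-1) ^+ L)).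
    rewrite ler_wpM2l // lerXn2r ?nnegrE ?invr_ge0 ?exprn_ge0 //.
      by case/andP: q01.
    apply: exp_le_half; rewrite ?mulfV ?gt_eqF // invr_ge0 ltW //= invf_le1 //.
    by rewrite ler1n S_gt0.
  rewrite exprVn ler_pdivrMr ?exprn_gt0 // mul1r -[n%:R]expr1.
  by apply: (le_trans (n_exp 1)); rewrite mul1n.
have HL1 : 0 <= harmonic_from2 R K1 <= L%:R by rewrite H0.
have h3 := slow_term HL1.
have h4 : 1 * (n%:R * slow_start R K K1 M) <= 1 by apply: slow_term; rewrite ler01 ler1n.
have h5 := failure_term HL1.
have h6 : ln K1%:R <= 3 * ln L%:R + ln S%:R :> R.
  rewrite -ln_L3 -lnM ?posrE ?ltr0n ?expn_gt0 ?L0 ?S_gt0 // -natrM.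
  by rewrite ler_ln ?posrE ?ltr0n ?muln_gt0 ?expn_gt0 ?L0 ?S_gt0 // ler_nat.
have h7 := ln_S_n.
rewrite mulrDl; lra.
Qed.

(** Here 3 ln L comes from [K2], which is S / L^3 rounded down. *)
Lemma params_lower : 2^-1 * ln n%:R - 3 * ln L%:R - 30 <= expected_value X.
Proof.
have K20 : (0 < K2)%N by apply: leq_trans K2_ge; rewrite expn_gt0 L0.
have H0 := harmonic_from2_ge0 R K2.
have HL := H_le K20 (leq_trans K2K1 K1_le_n).
have HL1 : 0 <= harmonic_from2 R K2 <= L%:R by rewrite H0.
apply: le_trans (expectation_lower n_gt0 m2n (leqnn (T1 + M)) X_cycles X_bounds K2K1 mK2 KK2n).
have h3 := slow_term HL1; have h5 := failure_term HL1.
have h1 : harmonic_from2 R K2 * ((((K + K2) * K.+1).*2 * K2 + K2 * K.+1)%:R / n%:R) <= 1.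
  apply: (@le_trans _ _ (L%:R * ((((K + K2) * K.+1).*2 * K2 + K2 * K.+1)%:R / n%:R))).
    by rewrite ler_wpM2r // divr_ge0.
  by rewrite mulrA ler_pdivrMr // mul1r -natrM ler_nat mulnC.
have h2 := harmonic_ge_ln K20.
have h4 : ln (2 : R) <= 1.
  have : ln (1 + 1 : R) <= 1 by rewrite le_ln1Dx // (@lt_trans _ _ 0) ?ltrN10.
  by rewrite -mulr2n.
have h6 : ln S%:R - 3 * ln L%:R <= ln K2.+1%:R :> R.
  rewrite lerBlDr -ln_L3 -lnM ?posrE ?ltr0n ?expn_gt0 ?L0 // -natrM.
  rewrite ler_ln ?posrE ?ltr0n ?muln_gt0 ?expn_gt0 ?L0 ?S_gt0 // ler_nat.
  by rewrite ltnW // ltn_ceil // expn_gt0 L0.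
have h7 := ln_n_S.
rewrite mulrBr mulr1; lra.
Qed.

End Scales.

(** With n < 2^L <= 2 n, L is at most 3 ln n, so ln L <= 2 + ln (ln n). As ln (ln n) >= 1, the
    constant 50 covers 3 (2 + ln (ln n)) + 30. *)
Lemma expected_card_bound (n : nat) (X : profile n -> R) (N0 : nat) :
  (forall L, (N0 <= L)%N -> (L ^ 10 <= 2 ^ uphalf L)%N) ->
  (2 ^ (N0 + 100) <= n)%N ->
  (forall P mu, is_minimum P (stable_matchings P) mu -> X P = #|cycles P mu|%:R) ->
  (forall P, 0 <= X P <= n%:R) ->
  `|expected_value X - 2^-1 * ln n%:R| <= 50 * ln (ln n%:R).
Proof.
move=> hN0 Nn X_cycles X_bounds.
have n0 : (0 < n)%N by apply: leq_trans Nn; rewrite expn_gt0.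
pose L := (trunc_log 2 n).+1.
have /andP[Ln nL] : (2 ^ (trunc_log 2 n) <= n < 2 ^ L)%N by apply: trunc_log_bounds.
have L_ge : (N0 + 100 <= L)%N.
  by apply: leqW; rewrite -[(N0 + 100)%N](@trunc_expnK 2) // leq_trunc_log.
have Ln2 : (2 ^ L <= 2 * n)%N by rewrite expnS leq_mul2l.
have L100 : (100 <= L)%N by apply: leq_trans L_ge; rewrite leq_addl.
have LS : (L ^ 10 <= 2 ^ uphalf L)%N by apply: hN0; apply: leq_trans L_ge; rewrite leq_addr.
have up := params_upper nL Ln2 L100 LS X_cycles X_bounds.
have lo := params_lower nL Ln2 L100 LS X_cycles X_bounds.
have ln2 : 2^-1 <= ln 2 :> R.
  have : ln (1 + - 2^-1) <= - 2^-1 :> R by rewrite le_ln1Dx // ltrN2 invf_lt1 ?ltr1n.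
  rewrite (_ : 1 + - 2^-1 = 2^-1); last by field.
  by rewrite lnV ?posrE // lerN2.
have L100r : 100 <= L%:R :> R by rewrite ler_nat.
have Lln : L%:R * 2^-1 <= ln n%:R + 1 :> R.
  have : ln (2 ^+ L) <= ln (2 * n%:R) :> R.
    by rewrite ler_ln ?posrE ?exprn_gt0 ?mulr_gt0 ?ltr0n // -natrX -natrM ler_nat.
  rewrite lnXn // lnM ?posrE ?ltr0n // -[ln 2 *+ L]mulr_natl.
  have : L%:R * 2^-1 - 2^-1 <= (L%:R - 1) * ln 2 :> R.
    by rewrite -{2}[2^-1]mul1r -mulrBl ler_wpM2l //; lra.
  lra.
have lnn : 4 <= ln n%:R :> R by lra.
have lnn0 : 0 < ln n%:R :> R by lra.
have lnln1 : 1 <= ln (ln n%:R) :> R.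
  have : ln (2 * 2) <= ln (ln n%:R) :> R by rewrite ler_ln ?posrE //; lra.
  by rewrite lnM ?posrE //; lra.
have lnL : ln L%:R <= 2 + ln (ln n%:R) :> R.
  have : ln L%:R <= ln ((1 + 2) * ln n%:R) :> R.
    by rewrite ler_ln ?posrE ?mulr_gt0 ?ltr0n //; lra.
  have : ln (1 + 2 : R) <= 2 by rewrite le_ln1Dx // (@lt_trans _ _ 0) ?ltrN10.
  rewrite lnM ?posrE //; lra.
by rewrite ler_norml; apply/andP; split; lra.
Qed.

End Asymptotics.

Local Open Scope classical_set_scope.
Local Open Scope ring_scope.

Theorem theorem5p1 (R : realType) (F : forall n : nat, profile n -> {set 'I_n})
    (hF : forall (n : nat) (P : profile n), minimum_winning_coalition P (F n P)) :
  (fun n : nat => expected_value (fun P : profile n => #|F n P|%:R : R))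
  = (fun n : nat => 2^-1 * ln n%:R) +O_\oo (fun n : nat => ln (ln n%:R)).
Proof.
have [N0 hN0] := pow10_le_half_exp.
apply/eqaddOP/bigO_exP; exists 50 => //; near=> n.
have Nn : (2 ^ (N0 + 100) <= n)%N by near: n; exact: nbhs_infty_ge.
apply: le_trans (expected_card_bound (X := fun P : profile n => #|F n P|%:R) hN0 Nn _ _) _.
- by move=> P mu min; rewrite (card_minimum_winning min (hF n P)).
- by move=> P; rewrite ler0n ler_nat -[leqRHS]card_ord max_card.
by rewrite ler_wpM2l // ler_norm.
Unshelve. all: by end_near.
Qed.
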